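(* Let $\Omega\subset\mathbb{R}^d$ be a bounded domain with outward unit normal $\boldsymbol\nu_{\partial\Omega}$, $\delta t_k>0$ a time step, and suppose that $(n^k,T^k,\mathbf u^k)$ and $(n^{k+1},T^{k+1},\mathbf u^{k+1})$ (sufficiently smooth, molar densities in $(0,1/b)$, temperatures positive) satisfy the following semi-implicit scheme: $$\mu^{k+1}=\mu_b^{\mathrm{convex}}(n^{k+1},T^{k+1})+\mu_b^{\mathrm{concave}}(n^k,T^{k+1})-\nabla\cdot(c^{k+1}\nabla n^{k+1}),$$ $$\mathbf u_\star^k=\mathbf u^k-\frac{\delta t_k}{\rho^k}\big(n^k\nabla\mu^{k+1}+s^k\nabla T^{k+1}\big),$$ $$\frac{n^{k+1}-n^k}{\delta t_k}+\nabla\cdot(n^k\mathbf u_\star^k)=0,$$ $$\rho^k\Big(\frac{\mathbf u^{k+1}-\mathbf u^k}{\delta t_k}+\mathbf u_\star^k\cdot\nabla\mathbf u^{k+1}\Big)=-n^k\nabla\mu^{k+1}+\gamma^k\nabla T^{k+1}+\nabla\cdot\big(\eta^kD(\mathbf u^{k+1})\big)+\nabla(\lambda^k\nabla\cdot\mathbf u^{k+1}),$$ $$\begin{aligned}\frac{\vartheta^{k+1}-\vartheta^k}{\delta t_k}+\nabla\cdot(\mathbf u_\star^ks^kT^{k+1})=&-\nabla\cdot\mathbf q^{k+1}-\nabla\cdot\big((\nabla\cdot(\mathbf u_\star^kn^k))c^{k+1}\nabla n^{k+1}\big)-\mu^{k+1}\nabla\cdot(\mathbf u_\star^kn^k)-\mathbf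 u_\star^k\cdot\gamma^k\nabla T^{k+1}\\&+\eta^kD(\mathbf u^{k+1}):\nabla\mathbf u^{k+1}+\lambda^k|\nabla\cdot\mathbf u^{k+1}|^2+\frac{1}{2\delta t_k}\rho^k\big(|\mathbf u^{k+1}-\mathbf u_\star^k|^2+|\mathbf u_\star^k-\mathbf u^k|^2\big),\end{aligned}$$ with $\mathbf q^{k+1}=-\Theta^k\nabla T^{k+1}$ and the boundary conditions described in the context. Let $\mathcal E^j=\frac12\int_\Omega\rho^j|\mathbf u^j|^2d\mathbf x+\int_\Omega\vartheta^jd\mathbf x$. Then the first law of thermodynamics holds: $$\frac{\mathcal E^{k+1}-\mathcal E^k}{\delta t_k}=-\int_{\partial\Omega}\mathbf q^{k+1}_{\partial\Omega}\cdot\boldsymbol\nu_{\partial\Omega}\,d\mathbf s,$$ where $\mathbf q^{k+1}_{\partial\Omega}$ denotes the heat transfer flux $\mathbf q^{k+1}$ on $\partial\Omega$.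
   Context: Constants: gas constant $R>0$, critical temperature $T_c>0$, critical pressure $P_c>0$, acentric factor $\omega$, molar weight $M_w>0$, reference values $T_0=298.15$ K, $P_0=1$ bar, $\vartheta_0=-2478.95687512$ J/mol, and heat capacity coefficients $\alpha_0,\dots,\alpha_3$. Put $T_r=T/T_c$, $\psi_p(T)=\sum_{i=0}^3\alpha_iT^i$, $$a(T)=0.45724\frac{R^2T_c^2}{P_c}\big[1+m(1-\sqrt{T_r})\big]^2,\qquad b=0.07780\frac{RT_c}{P_c},$$ where $m=0.37464+1.54226\omega-0.26992\omega^2$ if $\omega\le 0.49$ and $m=0.379642+1.485030\omega-0.164423\omega^2+0.016666\omega^3$ if $\omega>0.49$. Bulk (Peng-Robinson) Helmholtz free energy density: $f_b=f_b^{\mathrm{convex}}+f_b^{\mathrm{concave}}$, $f_b^{\mathrm{convex}}=f_b^{\mathrm{ideal}}+f_b^{\mathrm{repulsion}}$, $f_b^{\mathrm{concave}}=f_b^{\mathrm{attraction}}$, with $$f_b^{\mathrm{ideal}}=n\vartheta_0+n\sum_{i=0}^3\alpha_i\frac{T^{i+1}-T_0^{i+1}}{i+1}-nR(T-T_0)-nRT\ln\Big(\frac{P_0}{nRT}\Big)-nT\int_{T_0}^T\frac{\psi_p(\tau)}{\tau}d\tau,$$ $$f_b^{\mathrm{repulsion}}=-nRT\ln(1-bn),\qquad f_b^{\mathrm{attraction}}=\frac{a(T)n}{2\sqrt2\,b}\ln\Big(\frac{1+(1-\sqrt2)bn}{1+(1+\sqrt2)bn}\Big).$$ $\mu_b^{\mathrm{convex}}=\partial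 f_b^{\mathrm{convex}}/\partial n$, $\mu_b^{\mathrm{concave}}=\partial f_b^{\mathrm{concave}}/\partial n$. Influence parameter: $c(T)=a(T)b^{2/3}[\beta_1(1-T_r)+\beta_2]$, $\beta_1=-\frac{10^{-16}}{1.2326+1.3757\omega}$, $\beta_2=\frac{10^{-16}}{0.9051+1.5410\omega}$. Definitions: $f=f_b+\frac12c|\nabla n|^2$; $\gamma=\partial f_b/\partial T+\frac12c'(T)|\nabla n|^2$; entropy density $s=-\gamma$; internal energy density $\vartheta=f+Ts$; mass density $\rho=nM_w$. A superscript $j$ on $f,\gamma,s,\vartheta,\rho,c,\eta,\lambda,\Theta$ means evaluation at $(n^j,T^j)$. Shear viscosity $\eta>0$, volumetric viscosity $\xi>\frac23\eta$, $\lambda=\xi-\frac23\eta$; $D(\mathbf u)=\nabla\mathbf u+\nabla\mathbf u^T$; heat diffusion coefficient $\Theta=\Theta(n,T)\ge0$; $\mathbf v\cdot\nabla\mathbf u=(\mathbf v\cdot\nabla)\mathbf u$. Boundary conditions: $\mathbf u^j=0$ and $\nabla n^j\cdot\boldsymbol\nu_{\partial\Omega}=0$ on $\partial\Omega$ for $j=k,k+1$; in the definition of $\mathbf u_\star^k$ one takes $\nabla\mu^{k+1}\cdot\boldsymbol\nu_{\partial\Omega}=\nabla T^{k+1}\cdot\boldsymbol\nu_{\partial\Omega}=0$ on the boundary, and the convention is that $\mathbf u_\star^k=0$ on $\partial\Omega$. *)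

(* Defs.v *)
From HB Require Import structures.
From mathcomp Require Import all_boot all_order all_algebra.
From mathcomp Require Import all_classical all_reals all_analysis.
Set Implicit Arguments.
Unset Strict Implicit.
Unset Printing Implicit Defensive.
Import Order.TTheory GRing.Theory Num.Theory.
Import numFieldNormedType.Exports.
Local Open Scope classical_set_scope.
Local Open Scope ring_scope.

Section TupleMeasure.
Context {disp : measure_display} {T : measurableType disp} {R : realType}.

Section Cons.
Variables (n : nat) (m1 : {sigma_finite_measure set T -> \bar R})
  (m2 : {sigma_finite_measure set (n.-tuple T) -> \bar R}).

Definition tcons (p : T * n.-tuple T) : n.+1.-tuple T := [tuple of p.1 :: p.2].

Lemma measurable_tcons : measurable_fun setT tcons.
Proof. exact: measurable_cons. Qed.

Definition measure_tcons : set (n.+1.-tuple T) -> \bar R :=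
  pushforward (m1 \x m2)%E tcons.

Let mt0 : measure_tcons set0 = 0%E.
Proof. by rewrite /measure_tcons /pushforward preimage_set0 measure0. Qed.

Let mt_ge0 A : (0 <= measure_tcons A)%E.
Proof. by rewrite /measure_tcons /pushforward measure_ge0. Qed.

Let mt_sigma_additive : semi_sigma_additive measure_tcons.
Proof.
exact: (@measure_semi_sigma_additive _ _ _
  (measure_function_pushforward__canonical__measure_function_Measure
     (m1 \x m2)%E measurable_tcons)).
Qed.

HB.instance Definition _ := isMeasure.Build _ _ _
  measure_tcons mt0 mt_ge0 mt_sigma_additive.

Let mt_sigma_finite : sigma_finite setT measure_tcons.
Proof.
have /sigma_finiteP[F [TF ndF Foo]] := sigma_finiteT m1.
have /sigma_finiteP[G [TG ndG Goo]] := sigma_finiteT m2.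
pose h (t : n.+1.-tuple T) := (thead t, [tuple of behead t]).
have mh : measurable_fun setT h.
  by apply: measurable_fun_pair;
    [exact: measurable_tnth | exact: measurable_behead].
have tK : cancel tcons h by move=> [x t]; congr pair => //; apply: val_inj.
exists (fun k => h @^-1` (F k `*` G k)).
  apply/esym; rewrite -subTset => t _.
  have [k _ Fk] : (\bigcup_k F k) (h t).1 by rewrite -TF.
  have [l _ Gl] : (\bigcup_k G k) (h t).2 by rewrite -TG.
  exists (maxn k l) => //; split.
  - by move: Fk; exact/subsetPset/ndF/leq_maxl.
  - by move: Gl; exact/subsetPset/ndG/leq_maxr.
move=> k; have [mF Fk] := Foo k; have [mG Gk] := Goo k; split.
  by rewrite -[X in measurable X]setTI; apply: mh => //; exact: measurableX.
rewrite /measure_tcons /pushforward -comp_preimage.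
rewrite (_ : h \o tcons = id); last by apply/funext => p; exact: tK.
by rewrite preimage_id product_measure1E// lte_mul_pinfty// ge0_fin_numE.
Qed.

HB.instance Definition _ := Measure_isSigmaFinite.Build _ _ _
  measure_tcons mt_sigma_finite.
End Cons.

Fixpoint tuple_measure (m : {sigma_finite_measure set T -> \bar R}) (n : nat) :
    {sigma_finite_measure set (n.-tuple T) -> \bar R} :=
  match n with
  | 0 => dirac [tuple]
  | k.+1 => measure_tcons m (tuple_measure m k)
  end.

Lemma tuple_measure_box (m : {sigma_finite_measure set T -> \bar R}) n
    (A : 'I_n -> set T) : (forall i, measurable (A i)) ->
  tuple_measure m n [set t | forall i, A i (tnth t i)] =
  (\prod_(i < n) m (A i))%E.
Proof.
elim: n A => [|n IH] A mA.
  rewrite big_ord0 /= diracE mem_set//= => i.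
  by case: i.
rewrite big_ord_recl -(IH (fun i => A (lift ord0 i)))//.
rewrite /= /measure_tcons /pushforward.
rewrite (_ : _ @^-1` _ =
  A ord0 `*` [set t | forall i, A (lift ord0 i) (tnth t i)]); last first.
  apply/seteqP; split => -[x t] /=.
    move=> H; split; first by have := H ord0.
    by move=> i; have := H (lift ord0 i); rewrite tnthS.
  move=> [Ax At] i; case: (unliftP ord0 i) => [j ->|->//].
  by rewrite tnthS; exact: At.
rewrite product_measure1E//.
rewrite (_ : [set t | _] = \bigcap_(i in [set: 'I_n])
    ((fun t : n.-tuple T => tnth t i) @^-1` A (lift ord0 i))).
  apply: fin_bigcap_measurable; first exact: finite_finset.
  move=> i _; rewrite -[X in measurable X]setTI.
  by apply: (measurable_tnth i).
by apply/seteqP; split => t /= Ht i; [move=> _|]; exact: Ht.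
Qed.
End TupleMeasure.

Section RowBorel.
Variables (R : realType) (d : nat).

(* 'rV[R]_d has no measurable structure in the library; rvec R d is 'rV[R]_d
   with its Borel sigma-algebra. *)
Definition rvec : Type := g_sigma_algebraType (@open 'rV[R]_d).


Definition row_of_tuple (t : d.-tuple (measurableTypeR R)) : rvec :=
  \row_i (tnth t i : R).

Lemma measurable_row_of_tuple : measurable_fun setT row_of_tuple.
Proof.
apply: (@measurability _ _ _ _ _ row_of_tuple open) => // _ [U oU <-].
pose B (p : 'rV[rat]_d * nat) : set 'rV[R]_d :=
  [set x | forall i, `|x 0 i - ratr (p.1 0 i)| < p.2.+1%:R^-1].
have -> : row_of_tuple @^-1` U =
    \bigcup_(p in [set p | B p `<=` U]) (row_of_tuple @^-1` B p).
  apply/seteqP; split => [t /= Ut|t [p /= BU /BU //]].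
  have /nbhs_ballP[e /= e0 eU] : nbhs (row_of_tuple t : 'rV[R]_d) U.
    exact: open_nbhs_nbhs.
  pose k := Num.truncn (2 / e).
  have ke : k.+1%:R^-1 < e / 2.
    by rewrite -[ltRHS]invrK ltf_pV2 ?posrE ?invr_gt0 ?divr_gt0// invf_div truncnS_gt.
  have [q Hq] : exists q : 'rV[rat]_d, forall i,
      `|tnth t i - ratr (q 0 i)| < k.+1%:R^-1.
    have H i : exists q : rat, `|tnth t i - ratr q| < k.+1%:R^-1.
      have := @rat_in_itvoo R (tnth t i - k.+1%:R^-1) (tnth t i + k.+1%:R^-1).
      rewrite ltrD2l gtrN ?invr_gt0// => /(_ isT)[q].
      by rewrite in_itv/= => Hq; exists q; rewrite distrC ltr_distl.
    have [f Hf] := choice H.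
    by exists (\row_i f i) => i; rewrite mxE.
  exists (q, k); last by move=> i; rewrite mxE.
  move=> x /= Bx; apply: eU; split => // i0 j.
  rewrite (ord1 i0) /ball /= mxE (splitr e).
  rewrite -[X in `|X|](subrKA (ratr (q 0 j))).
  apply: (le_lt_trans (ler_normD _ _)); rewrite ltrD//.
    exact: lt_trans ke.
  by rewrite distrC; exact: lt_trans ke.
rewrite setTI bigcup_mkcond; apply: countable_bigcupT_measurable => // -[q k].
case: ifP => _; last exact: measurable0.
rewrite (_ : _ @^-1` _ = \bigcap_(i in [set: 'I_d])
    ((fun t : d.-tuple (measurableTypeR R) => tnth t i) @^-1`
      ball (ratr (q 0 i) : R) k.+1%:R^-1)).
  apply: fin_bigcap_measurable; first exact: finite_finset.
  move=> i _; rewrite -[X in measurable X]setTI.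
  by apply: (measurable_tnth i measurableT); rewrite ball_itv; exact: measurable_itv.
apply/seteqP; split => t /= Ht i; last by rewrite mxE distrC; exact: Ht.
by move=> _; have := Ht i; rewrite mxE distrC.
Qed.

Definition lebesgue_rV : set rvec -> \bar R :=
  pushforward (tuple_measure lebesgue_measure d) row_of_tuple.

Let lebesgue_rV0 : lebesgue_rV set0 = 0%E.
Proof. by rewrite /lebesgue_rV /pushforward preimage_set0 measure0. Qed.

Let lebesgue_rV_ge0 A : (0 <= lebesgue_rV A)%E.
Proof. by rewrite /lebesgue_rV /pushforward measure_ge0. Qed.

Let lebesgue_rV_sigma_additive : semi_sigma_additive lebesgue_rV.
Proof.
exact: (@measure_semi_sigma_additive _ _ _
  (measure_function_pushforward__canonical__measure_function_Measure
     (tuple_measure lebesgue_measure d) measurable_row_of_tuple)).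
Qed.

HB.instance Definition _ := isMeasure.Build _ _ _
  lebesgue_rV lebesgue_rV0 lebesgue_rV_ge0 lebesgue_rV_sigma_additive.

Lemma lebesgue_rV_box (A : 'I_d -> set (measurableTypeR R)) :
    (forall i, measurable (A i)) ->
  lebesgue_rV [set x | forall i, A i (x 0 i)] =
  (\prod_(i < d) lebesgue_measure (A i))%E.
Proof.
move=> mA; rewrite -tuple_measure_box//; congr (tuple_measure _ _ _).
by apply/seteqP; split => t /= Ht i; have := Ht i; rewrite mxE.
Qed.

End RowBorel.

Section VectorCalculus.
Variables (R : realType) (d : nat).
Local Notation V := 'rV[R]_d.

(* The library norm on 'rV[R]_d is the sup norm, so |v|^2 is dotv v v. *)
Definition dotv (v w : V) : R := \sum_(i < d) v 0 i * w 0 i.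

Definition ddot (A B : 'M[R]_d) : R := \sum_(i < d) \sum_(j < d) A i j * B i j.

Definition pd (i : 'I_d) (f : V -> R) (x : V) : R := 'D_(delta_mx 0 i) f x.

Definition grad (f : V -> R) (x : V) : V := \row_i pd i f x.

Definition divg (F : V -> V) (x : V) : R :=
  \sum_(i < d) pd i (fun y => F y 0 i) x.

(* (nabla u)_ij = d_i u_j, so that (v . nabla) u = v *m nabla u for row vectors *)
Definition gradv (u : V -> V) (x : V) : 'M[R]_d :=
  \matrix_(i, j) pd i (fun y => u y 0 j) x.

Definition divm (A : V -> 'M[R]_d) (x : V) : V :=
  \row_j \sum_(i < d) pd i (fun y => A y i j) x.

Definition symgrad (u : V -> V) (x : V) : 'M[R]_d := gradv u x + (gradv u x)^T.

Fixpoint Ck (k : nat) (U : set V) (f : V -> R) : Prop :=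
  (forall x, U x -> {for x, continuous f}) /\
  match k with
  | 0 => True
  | l.+1 => forall i : 'I_d,
      (forall x, U x -> derivable f x (delta_mx 0 i)) /\ Ck l U (pd i f)
  end.

(* C^k up to the boundary: C^k on some open neighbourhood of the closure. *)
Definition Ck_closure (k : nat) (Omega : set V) (f : V -> R) : Prop :=
  exists U : set V, [/\ open U, closure Omega `<=` U & Ck k U f].

Definition Ckv_closure (k : nat) (Omega : set V) (F : V -> V) : Prop :=
  forall i : 'I_d, Ck_closure k Omega (fun x => F x 0 i).

Definition boundary (Omega : set V) : set V :=
  closure Omega `\` interior Omega.

Definition bounded_domain (Omega : set V) : Prop :=
  [/\ Omega !=set0, open Omega, connected Omega & bounded_set Omega].

Definition C1_compact_support (F : V -> V) : Prop :=
  (forall i : 'I_d, Ck 1 setT (fun x => F x 0 i)) /\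
  compact (closure [set x | F x != 0]).

(* De Giorgi's surface measure sigma and outward unit normal nu of a set of
   finite perimeter: nu sigma = - D 1_Omega in the sense of distributions on
   the whole space, |nu| = 1 sigma-almost everywhere, and sigma is carried by
   the topological boundary.  This determines sigma, and determines nu
   sigma-almost everywhere; for a Lipschitz domain they are the
   (d-1)-dimensional surface measure and the usual outward unit normal. *)
Definition outward_normal (Omega : set V)
    (sigma : {finite_measure set (rvec R d) -> \bar R}) (nu : V -> V) : Prop :=
  [/\ forall i : 'I_d, measurable_fun setT (fun x : rvec R d => nu x 0 i),
      {ae sigma, forall x, dotv (nu x) (nu x) = 1},
      sigma (~` boundary Omega) = 0%E
    & forall F : V -> V, C1_compact_support F ->
        \int[@lebesgue_rV R d]_(x in Omega) divg F x =
        \int[sigma]_(x in boundary Omega) dotv (F x) (nu x)].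

End VectorCalculus.

Section PengRobinson.
Variable R : realType.

(* decimal n [:: d1; d2; d3] is the number n.d1d2d3 *)
Definition decimal (n : nat) (s : seq nat) : R :=
  n%:R + foldr (fun c x => (c%:R + x) / 10) 0 s.

(* SI units: K, Pa (1 bar = 10^5 Pa), J/mol *)
Definition Tref : R := decimal 298 [:: 1; 5]%N.
Definition Pref : R := 10 ^+ 5.
Definition thetaref : R := - decimal 2478 [:: 9; 5; 6; 8; 7; 5; 1; 2]%N.

Record fluid := Fluid {
  Rgas : R;
  Tcrit : R;
  Pcrit : R;
  acentric : R;
  Mweight : R;
  hcap : 'I_4 -> R;
  Rgas_gt0 : 0 < Rgas;
  Tcrit_gt0 : 0 < Tcrit;
  Pcrit_gt0 : 0 < Pcrit;
  Mweight_gt0 : 0 < Mweight }.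

Variable F : fluid.
Local Notation w := (acentric F).

Definition m_coef : R :=
  if w <= decimal 0 [:: 4; 9]%N then
    decimal 0 [:: 3; 7; 4; 6; 4]%N + decimal 1 [:: 5; 4; 2; 2; 6]%N * w
    - decimal 0 [:: 2; 6; 9; 9; 2]%N * w ^+ 2
  else
    decimal 0 [:: 3; 7; 9; 6; 4; 2]%N + decimal 1 [:: 4; 8; 5; 0; 3; 0]%N * w
    - decimal 0 [:: 1; 6; 4; 4; 2; 3]%N * w ^+ 2
    + decimal 0 [:: 0; 1; 6; 6; 6; 6]%N * w ^+ 3.

Definition a_coef (T : R) : R :=
  decimal 0 [:: 4; 5; 7; 2; 4]%N * (Rgas F ^+ 2 * Tcrit F ^+ 2 / Pcrit F)
  * (1 + m_coef * (1 - Num.sqrt (T / Tcrit F))) ^+ 2.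

Definition b_coef : R :=
  decimal 0 [:: 0; 7; 7; 8; 0]%N * (Rgas F * Tcrit F / Pcrit F).

Definition psi_p (T : R) : R := \sum_(i < 4) hcap F i * T ^+ i.

(* oriented integral: T may lie on either side of Tref *)
Definition oint (a b : R) (f : R -> R) : R :=
  if a <= b then \int[lebesgue_measure]_(t in `[a, b]) f t
  else - \int[lebesgue_measure]_(t in `[b, a]) f t.

Definition f_ideal (n T : R) : R :=
  n * thetaref
  + n * (\sum_(i < 4) hcap F i * ((T ^+ i.+1 - Tref ^+ i.+1) / i.+1%:R))
  - n * Rgas F * (T - Tref)
  - n * Rgas F * T * ln (Pref / (n * Rgas F * T))
  - n * T * oint Tref T (fun t => psi_p t / t).

Definition f_repulsion (n T : R) : R := - (n * Rgas F * T * ln (1 - b_coef * n)).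

Definition f_attraction (n T : R) : R :=
  a_coef T * n / (2 * Num.sqrt 2 * b_coef)
  * ln ((1 + (1 - Num.sqrt 2) * b_coef * n) / (1 + (1 + Num.sqrt 2) * b_coef * n)).

Definition f_convex (n T : R) : R := f_ideal n T + f_repulsion n T.
Definition f_concave (n T : R) : R := f_attraction n T.
Definition f_bulk (n T : R) : R := f_convex n T + f_concave n T.

Definition mu_convex (n T : R) : R := derive1 (fun r => f_convex r T) n.
Definition mu_concave (n T : R) : R := derive1 (fun r => f_concave r T) n.
Definition f_bulk_dT (n T : R) : R := derive1 (fun t => f_bulk n t) T.

Definition beta1 : R :=
  - (10 ^- 16 / (decimal 1 [:: 2; 3; 2; 6]%N + decimal 1 [:: 3; 7; 5; 7]%N * w)).
Definition beta2 : R :=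
  10 ^- 16 / (decimal 0 [:: 9; 0; 5; 1]%N + decimal 1 [:: 5; 4; 1; 0]%N * w).

Definition c_infl (T : R) : R :=
  a_coef T * (b_coef `^ (2 / 3)) * (beta1 * (1 - T / Tcrit F) + beta2).

Section Densities.
Variable d : nat.
Implicit Types (n T : 'rV[R]_d -> R) (x : 'rV[R]_d).

Definition helmholtz n T x : R :=
  f_bulk (n x) (T x) + 2^-1 * c_infl (T x) * dotv (grad n x) (grad n x).

Definition gamma n T x : R :=
  f_bulk_dT (n x) (T x) + 2^-1 * derive1 c_infl (T x) * dotv (grad n x) (grad n x).

Definition entropy n T x : R := - gamma n T x.

Definition internal_energy n T x : R := helmholtz n T x + T x * entropy n T x.

Definition mass_density n x : R := n x * Mweight F.

Definition total_energy (Omega : set 'rV[R]_d) n T (u : 'rV[R]_d -> 'rV[R]_d) : R :=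
  2^-1 * (\int[@lebesgue_rV R d]_(x in Omega) (mass_density n x * dotv (u x) (u x)))
  + \int[@lebesgue_rV R d]_(x in Omega) internal_energy n T x.

End Densities.
End PengRobinson.

(* Main.v *)
Require Import Defs.
From HB Require Import structures.
From mathcomp Require Import all_boot all_order all_algebra.
From mathcomp Require Import all_classical all_reals all_analysis.
From mathcomp Require Import measurable_realfun.
From mathcomp Require Import ring lra.
Set Implicit Arguments.
Unset Strict Implicit.
Unset Printing Implicit Defensive.
Import Order.TTheory GRing.Theory Num.Theory.
Import numFieldNormedType.Exports.
Local Open Scope classical_set_scope.
Local Open Scope ring_scope.

(* Take the inner product of the momentum equation with u1, replace
   n0 grad mu + s0 grad T1 by - rho0 (us - u0) / dt, and add the energy equation:
   the quadratic terms in u1 - us and us - u0 are exactly what turns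
   rho0 (us - u0) . u1 into rho0 (us - u0) . us, so that on Omega the discrete
   time derivative of the total energy density is - div H for an explicit field
   H.  On the boundary us, u1 and grad n1 . nu vanish, leaving H . nu = q . nu.
   The definition of sigma and nu only gives the divergence theorem for
   compactly supported C^1 fields on the whole space; hence H must be C^1 on a
   neighbourhood of the closure (which requires the regularity of the equation of
   state) and is then multiplied by a C^1 cutoff. *)

(** The cancellation rests on [|u1|^2 - |u0|^2 = 2 (u1 - us) . u1 + 2 (us - u0) . us - |u1 - us|^2 -
    |us - u0|^2]. The definition of [us] turns [rho0 (us - u0) . us / dt] into
    [- n0 grad mu . us + gamma0 grad T1 . us]: the temperature part cancels the work term of the
    energy equation, and the other part joins [mu div (n0 us)] into [div (mu n0 us)]. The continuity
    equation does the same for the convection of kinetic energy, and viscous work plus dissipation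
    is again a divergence. Regularity has its own obstacle: the entropy inside [H] contains the
    temperature derivative of [f_b], a function of two variables with an integral in it, whereas
    derivatives are taken along axes only. Writing [f_b] through functions of one variable reduces
    everything to sums, products and a chain rule with a scalar outer function. *)

(** * Classes [C^k] along a family of directions *)

Section DirectionalSmoothness.
Variable R : realType.

Section Domain.
Variables (V : normedModType R) (I : Type) (e : I -> V).
Implicit Types (k : nat) (U : set V) (f g : V -> R).

(* Mirrors Ck with arbitrary directions, so that the closure properties below
   serve both fields on row vectors and functions of one real variable. *)
Fixpoint Ck_dir k U f : Prop :=
  (forall x, U x -> {for x, continuous f}) /\
  match k with
  | 0 => True
  | l.+1 => forall i : I,
      (forall x, U x -> derivable f x (e i)) /\
      Ck_dir l U (fun x => 'D_(e i) f x)
  end.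

Lemma Ck_dir_cont k U f x : Ck_dir k U f -> U x -> {for x, continuous f}.
Proof. by case: k => [|k] [fc _]; exact: fc. Qed.

Lemma Ck_dirW k U f : Ck_dir k.+1 U f -> Ck_dir k U f.
Proof.
elim: k f => [|k IH] f [fc fd]; first by [].
by split => // i; have [fi fI] := fd i; split => //; exact: IH.
Qed.

Lemma sub_Ck_dir k U W f : W `<=` U -> Ck_dir k U f -> Ck_dir k W f.
Proof.
move=> WU; elim: k f => [|k IH] f [fc fd]; split => //.
- by move=> x /WU /fc.
- by move=> x /WU /fc.
- by move=> i; have [fi fI] := fd i; split; [move=> x /WU /fi|exact: IH].
Qed.

(** Continuity and derivability are asked at points of the whole space, not relative to the set, so
    no overlap condition arises. This glues a cutoff field to its extension by zero. *)
Lemma Ck_dirU k U W f : Ck_dir k U f -> Ck_dir k W f -> Ck_dir k (U `|` W) f.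
Proof.
elim: k f => [|k IH] f [fc fd] [gc gd]; split => //.
- by move=> x [/fc|/gc].
- by move=> x [/fc|/gc].
- move=> i; have [fi fI] := fd i; have [gi gI] := gd i.
  by split; [move=> x [/fi|/gi]|exact: IH].
Qed.

Lemma near_open U x (P : V -> Prop) : open U -> U x -> (forall y, U y -> P y) ->
  \forall y \near x, P y.
Proof.
move=> oU Ux UP; have /filterS : nbhs x U by exact: open_nbhs_nbhs.
by apply.
Qed.

(** The rules for derivatives of sums, products and composites hold only on [U]; openness makes them
    hold near each point, so they survive the next differentiation. *)
Lemma eq_Ck_dir k U f g : open U -> (forall x, U x -> f x = g x) ->
  Ck_dir k U f -> Ck_dir k U g.
Proof.
move=> oU; elim: k f g => [|k IH] f g fg [fc fd].
  split => // x Ux; have := fc x Ux; rewrite /prop_for /continuous_at -(fg x Ux).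
  apply: cvg_trans; apply: near_eq_cvg.
  by apply: (near_open oU Ux) => y /fg.
have fgn x : U x -> \forall y \near x, f y = g y.
  by move=> Ux; apply: (near_open oU Ux) => y /fg.
split.
  move=> x Ux; have := fc x Ux; rewrite /prop_for /continuous_at -(fg x Ux).
  by apply: cvg_trans; apply: near_eq_cvg; exact: fgn.
move=> i; have [fi fI] := fd i; split.
  by move=> x Ux; apply: near_eq_derivable (fi x Ux); exact: fgn.
apply: IH fI => x Ux; apply: near_eq_derive; exact: fgn.
Qed.

Lemma Ck_dir_cst k U (c : R) : Ck_dir k U (fun=> c).
Proof.
elim: k c => [|k IH] c; split => //.
- by move=> x _; exact: cst_continuous.
- by move=> x _; exact: cst_continuous.
- move=> i; split; first by move=> x _; exact: derivable_cst.
  have -> : (fun x => 'D_(e i) (fun=> c) x) = (fun=> 0 : R).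
    by apply/funext => x; exact: (derive_cst c).
  exact: IH.
Qed.

Lemma Ck_dirD k U f g : open U -> Ck_dir k U f -> Ck_dir k U g ->
  Ck_dir k U (fun x => f x + g x).
Proof.
move=> oU; elim: k f g => [|k IH] f g [fc fd] [gc gd].
  by split => // x Ux; apply: continuousD; [exact: fc|exact: gc].
split; first by move=> x Ux; apply: continuousD; [exact: fc|exact: gc].
move=> i; have [fi fI] := fd i; have [gi gI] := gd i; split.
  by move=> x Ux; apply: derivableD; [exact: fi|exact: gi].
apply: (eq_Ck_dir oU) (IH _ _ fI gI) => x Ux.
by rewrite -deriveD//; [exact: fi|exact: gi].
Qed.

Lemma Ck_dirM k U f g : open U -> Ck_dir k U f -> Ck_dir k U g ->
  Ck_dir k U (fun x => f x * g x).
Proof.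
move=> oU; elim: k f g => [|k IH] f g Cf Cg; case: (Cf) => fc fd; case: (Cg) => gc gd.
  by split => // x Ux; apply: continuousM; [exact: fc|exact: gc].
split; first by move=> x Ux; apply: continuousM; [exact: fc|exact: gc].
move=> i; have [fi fI] := fd i; have [gi gI] := gd i; split.
  by move=> x Ux; apply: derivableM; [exact: fi|exact: gi].
apply: (eq_Ck_dir oU) (Ck_dirD oU (IH _ _ (Ck_dirW Cf) gI) (IH _ _ (Ck_dirW Cg) fI)).
by move=> x Ux; rewrite deriveM//; [exact: fi|exact: gi].
Qed.

Lemma Ck_dirZ k U (c : R) f : open U -> Ck_dir k U f ->
  Ck_dir k U (fun x => c * f x).
Proof. by move=> oU; apply: Ck_dirM => //; exact: Ck_dir_cst. Qed.

Lemma Ck_dirN k U f : open U -> Ck_dir k U f -> Ck_dir k U (fun x => - f x).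
Proof.
move=> oU Cf; apply: (eq_Ck_dir oU) (Ck_dirZ (-1) oU Cf) => x _.
by rewrite mulN1r.
Qed.

Lemma Ck_dirB k U f g : open U -> Ck_dir k U f -> Ck_dir k U g ->
  Ck_dir k U (fun x => f x - g x).
Proof. by move=> oU Cf Cg; apply: Ck_dirD => //; exact: Ck_dirN. Qed.

Lemma Ck_dirX k U f m : open U -> Ck_dir k U f -> Ck_dir k U (fun x => f x ^+ m).
Proof.
move=> oU Cf; elim: m => [|m IH]; first exact: Ck_dir_cst.
apply: (eq_Ck_dir oU) (Ck_dirM oU Cf IH) => x _.
by rewrite exprS.
Qed.

Lemma Ck_dir_sum k U (J : Type) (s : seq J) (P : pred J) (h : J -> V -> R) :
  open U -> (forall j, P j -> Ck_dir k U (h j)) ->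
  Ck_dir k U (fun x => \sum_(j <- s | P j) h j x).
Proof.
move=> oU Ch; rewrite (_ : (fun x => _) = \sum_(j <- s | P j) h j); last first.
  by apply/funext => x; rewrite fct_sumE.
elim/big_ind: _ => //; first exact: Ck_dir_cst.
by move=> f g; exact: Ck_dirD.
Qed.

Lemma Ck_dir_prod k U (J : Type) (s : seq J) (P : pred J) (h : J -> V -> R) :
  open U -> (forall j, P j -> Ck_dir k U (h j)) ->
  Ck_dir k U (fun x => \prod_(j <- s | P j) h j x).
Proof.
move=> oU Ch; rewrite (_ : (fun x => _) = \prod_(j <- s | P j) h j); last first.
  by apply/funext => x; rewrite fct_prodE.
elim/big_ind: _ => //; first exact: Ck_dir_cst.
by move=> f g; exact: Ck_dirM.
Qed.

Lemma derive1P f x v : 'D_v f x = 'D_1 (fun t : R => f (t *: v + x)) 0.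
Proof.
rewrite /derive; set g1 := fun h : R => h^-1 *: _; set g2 := fun h : R => h^-1 *: _.
suff -> : g1 = g2 by [].
by rewrite funeqE /g1 /g2 => t /=; rewrite addr0 scale0r add0r [_%:A]mulr1.
Qed.

(** Restricting [f] to the line through [x] along [v] leaves two functions of one real variable, so
    directional derivability of [f] is enough. *)
Lemma is_derive_chain (f : V -> R) (g : R -> R) x v :
  derivable f x v -> derivable g (f x) 1 ->
  is_derive x v (g \o f) ('D_1 g (f x) * 'D_v f x).
Proof.
move=> df dg; pose p (h : R) : R := f (h *: v + x).
have p0 : p 0 = f x by rewrite /p scale0r add0r.
have /derivableP dp : derivable p 0 1 := (derivable1P f x v).1 df.
have /derivableP dg0 : derivable g (p 0) 1 by rewrite p0.
have [dcmp Ecmp] := is_derive1_comp dg0 dp.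
have gpE : g \o p = fun t : R => (g \o f) (t *: v + x) by [].
apply: DeriveDef; first by apply: (derivable1P (g \o f) x v).2; rewrite -gpE.
by rewrite (derive1P (g \o f)) -gpE Ecmp p0 (derive1P f).
Qed.

End Domain.

Definition Ck_real (k : nat) (D : set R) (g : R -> R) : Prop :=
  @Ck_dir R^o unit (fun=> 1) k D g.

(** The derivative is [g'(f)] times that of [f], so the induction has to vary the outer function;
    being scalar, [g'] is again of the same kind. *)
Lemma Ck_dir_comp (V : normedModType R) (I : Type) (e : I -> V) k U D f g :
  open U -> (forall x, U x -> D (f x)) ->
  Ck_dir e k U f -> Ck_real k D g -> Ck_dir e k U (fun x => g (f x)).
Proof.
move=> oU UD; elim: k f UD g => [|k IH] f UD g Cf Cg;
  case: (Cf) => fc fd; case: (Cg) => gc gd.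
  split => // x Ux; apply: continuous_comp; first exact: fc.
  exact/gc/UD.
split.
  by move=> x Ux; apply: continuous_comp; [exact: fc|exact/gc/UD].
move=> i; have [fi fI] := fd i; have [gi gI] := gd tt; split.
  move=> x Ux; have [//] := is_derive_chain (fi x Ux) (gi _ (UD _ Ux)).
apply: (eq_Ck_dir oU) (Ck_dirM oU (IH _ UD _ (Ck_dirW Cf) gI) fI) => x Ux.
by have [_ ->] := is_derive_chain (fi x Ux) (gi _ (UD _ Ux)).
Qed.

(** An explicit derivative raises the order by one. Functions whose derivative is expressed through
    themselves, such as the inverse and the square root, become smooth by induction on [k]. *)
Lemma Ck_realS k (D : set R) (g h : R -> R) : open D ->
  (forall x, D x -> is_derive x 1 g (h x)) -> Ck_real k D h -> Ck_real k.+1 D g.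
Proof.
move=> oD gh Ch; split.
  move=> x Dx; apply: differentiable_continuous; apply/derivable1_diffP.
  by have [] := gh _ Dx.
move=> _; split; first by move=> x /gh[].
by apply: (eq_Ck_dir oD) Ch => x /gh[_ ->].
Qed.

Lemma Ck_real_derive k (D : set R) (g : R -> R) :
  Ck_real k.+1 D g -> Ck_real k D (derive1 g).
Proof.
case=> _ /(_ tt)[_]; rewrite (_ : (fun x : R => _) = derive1 g)//.
by apply/funext => x; rewrite derive1E.
Qed.

Lemma Ck_real_id k : Ck_real k setT id.
Proof.
case: k => [|k]; first by split => // x _; exact: cvg_id.
have did (x : R) : setT x -> is_derive x 1 id (1 : R).
  by move=> _; exact: is_derive_id.
by apply: (Ck_realS openT did); exact: Ck_dir_cst.
Qed.

Definition positives : set R := [set x | 0 < x].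

Lemma open_positives : open positives.
Proof. exact: open_gt. Qed.

Lemma Ck_real_inv k : Ck_real k [set x | x != 0] GRing.inv.
Proof.
have o0 : open [set x : R | x != 0] by exact: open_neq.
have d0 (x : R) : x != 0 -> is_derive x 1 GRing.inv (- (x^-1 ^+ 2)).
  move=> x0; have did : derivable (@id R) x 1 by exact: derivable_id.
  split; first exact: (@derivableV _ _ (@id R) x 1 x0 did).
  rewrite (@deriveV _ _ (@id R) x 1 x0 did).
  by rewrite derive_id [LHS]mulr1 exprVn.
elim: k => [|k IH].
  by split => // x x0; exact: inv_continuous.
apply: (Ck_realS o0 d0); apply: Ck_dirN => //; exact: Ck_dirX.
Qed.

Lemma Ck_real_ln k : Ck_real k positives (@ln R).
Proof.
case: k => [|k]; first by split => // x x0; exact: continuous_ln.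
have dln (x : R) : positives x -> is_derive x 1 (@ln R) x^-1.
  by move=> x0; exact: is_derive1_ln.
apply: (Ck_realS open_positives dln).
by apply: (sub_Ck_dir _ (@Ck_real_inv k)) => x /= x0; exact: lt0r_neq0.
Qed.

Lemma Ck_real_sqrt k : Ck_real k positives Num.sqrt.
Proof.
elim: k => [|k IH]; first by split => // x _; exact: sqrt_continuous.
have dsqrt (x : R) : positives x -> is_derive x 1 Num.sqrt (2 * Num.sqrt x)^-1.
  by move=> x0; exact: is_derive1_sqrt.
apply: (Ck_realS open_positives dsqrt).
apply: (@Ck_dir_comp _ _ _ _ _ [set x | x != 0] (fun x => 2 * Num.sqrt x) GRing.inv
  open_positives).
- by move=> x /= x0; rewrite mulf_neq0// lt0r_neq0// sqrtr_gt0.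
- by apply: Ck_dirZ => //; exact: open_positives.
- exact: Ck_real_inv.
Qed.

End DirectionalSmoothness.

(** * Differentiating the oriented integral in its upper bound *)

Section OrientedIntegral.
Variables (R : realType) (f : R -> R).
Hypothesis fc : forall x : R, 0 < x -> {for x, continuous f}.

Lemma integrable_segment (a b : R) : 0 < a ->
  lebesgue_measure.-integrable `[a, b] (EFin \o f).
Proof.
move=> a0; apply: continuous_compact_integrable; first exact: segment_compact.
apply: continuous_in_subspaceT => x /[!inE] /=; rewrite in_itv/= => /andP[ax _].
exact/fc/(lt_le_trans a0).
Qed.

(** A base point [a] below both bounds lets additivity over intervals absorb the two cases of [oint]
    into one difference. *)
Lemma oint_base (a c t : R) : 0 < a -> a < c -> a < t ->
  oint c t f = \int[lebesgue_measure]_(x in `[a, t]) f x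
               - \int[lebesgue_measure]_(x in `[a, c]) f x.
Proof.
have chasles (x y : R) : 0 < a -> a < x -> x <= y ->
    \int[lebesgue_measure]_(z in `[a, y]) f z -
    \int[lebesgue_measure]_(z in `[a, x]) f z =
    \int[lebesgue_measure]_(z in `[x, y]) f z.
  move=> a0 ax xy; rewrite Rintegral_itvB ?bnd_simp ?(ltW ax)//; last first.
    exact: integrable_segment.
  rewrite Rintegral_itv_obnd_cbnd//.
  apply: integrableS (integrable_segment y (lt_trans a0 ax)) => //.
  by apply: subset_itvr; rewrite bnd_simp.
move=> a0 ac at'; rewrite /oint; case: ifPn => [ct|]; first by rewrite -chasles.
by rewrite -ltNge => /ltW tc; rewrite -chasles// opprB.
Qed.

Lemma is_derive_oint (c T : R) : 0 < c -> 0 < T ->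
  is_derive T 1 (fun t => oint c t f) (f T).
Proof.
(* Half the minimum is below both [c] and [T] and still positive, so [f] is continuous on every
   interval used; the end [T + 1] makes [T] an interior point. *)
move=> c0 T0; pose a := Num.min c T / 2.
have m0 : 0 < Num.min c T by rewrite lt_min c0.
have a0 : 0 < a by rewrite divr_gt0.
have am : a < Num.min c T by rewrite ltr_pdivrMr// mulr_natr mulr2n ltrDl.
have /andP[ac aT] : (a < c) && (a < T) by move: am; rewrite lt_min.
have TT : T < T + 1 by rewrite ltrDl.
have [dF EF] := continuous_FTC1_closed TT (integrable_segment (T + 1) a0) aT (fc T0).
pose G t := \int[lebesgue_measure]_(x in `[a, t]) f x
               - \int[lebesgue_measure]_(x in `[a, c]) f x.
apply: (@near_eq_is_derive _ _ _ G).
  apply: (near_open (@open_gt R a)) => // y /= ay.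
  by rewrite (oint_base a0 ac ay).
have dc := is_derive_cst (\int[lebesgue_measure]_(x in `[a, c]) f x) T (1 : R).
have := is_deriveB (derivableP dF) dc.
by rewrite subr0 -derive1E EF.
Qed.

End OrientedIntegral.

(* Each rule is selected by the syntactic head of the function, which keeps
   unification from unfolding the ring operations. *)
Ltac smooth :=
  unfold Ck_real in *;
  repeat match goal with
    | H : ?G |- ?G' => constr_eq G G'; exact H
    | |- Ck_dir _ _ _ (fun=> _) => exact: Ck_dir_cst
    | H : Ck_dir _ _ _ id |- Ck_dir _ _ _ (fun x => x) => exact H
    | |- Ck_dir _ _ _ (fun x => @GRing.add _ (@?f x) (@?g x)) => apply: Ck_dirD
    | |- Ck_dir _ _ _ (fun x => @GRing.opp _ (@?f x)) => apply: Ck_dirN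
    | |- Ck_dir _ _ _ (fun x => @GRing.mul _ (@?f x) (@?g x)) => apply: Ck_dirM
    | |- Ck_dir _ _ _ (@GRing.mul _ ?c) => apply: (Ck_dirZ c)
    | |- Ck_dir _ _ _ (fun x => @GRing.exp _ (@?f x) _) => apply: Ck_dirX
    | |- Ck_dir _ _ _ (fun x => \sum_(i < _) _) => apply: Ck_dir_sum => // ? _
    end.

(** * Regularity of the Peng-Robinson energy *)

Section EquationOfState.
Variables (R : realType) (F : fluid R).
Implicit Types n T : R.

(** The factor multiplying [n] in the separated form of [f_b]. The term [Rgas F * (T * ln T)] is
    what the split of the logarithm of [P_0 / (n R T)] contributes in [T] alone. *)
Definition thermal_part T : R :=
  thetaref R + \sum_(i < 4) hcap F i * ((T ^+ i.+1 - Tref R ^+ i.+1) / i.+1%:R)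
  - Rgas F * (T - Tref R) + Rgas F * (T * ln T)
  - T * oint (Tref R) T (fun t => psi_p F t / t).

Definition configurational_part n : R :=
  - (Rgas F * (n * (ln (Pref R / (n * Rgas F)) + ln (1 - b_coef F * n)))).

Definition attraction_part n : R :=
  n / (2 * Num.sqrt 2 * b_coef F)
  * ln ((1 + (1 - Num.sqrt 2) * b_coef F * n) / (1 + (1 + Num.sqrt 2) * b_coef F * n)).

Lemma Tref_gt0 : 0 < Tref R.
Proof. by rewrite /Tref /decimal /=; lra. Qed.

Lemma Pref_gt0 : 0 < Pref R.
Proof. by rewrite exprn_gt0. Qed.

Lemma b_coef_gt0 : 0 < b_coef F.
Proof.
rewrite /b_coef mulr_gt0 ?divr_gt0 ?mulr_gt0 ?Rgas_gt0 ?Tcrit_gt0 ?Pcrit_gt0//.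
by rewrite /decimal /=; lra.
Qed.

(* Only n * ln (P_0 / (n R T)) couples n and T, and for positive arguments this
   logarithm splits; so f_b is a finite sum of products A(n) B(T). *)
Lemma f_bulkE n T : 0 < n -> 0 < T ->
  f_bulk F n T = n * thermal_part T + T * configurational_part n
                 + a_coef F T * attraction_part n.
Proof.
move=> n0 T0; rewrite /f_bulk /f_convex /f_concave /f_ideal /f_repulsion
  /f_attraction /thermal_part /configurational_part /attraction_part.
have nR : 0 < n * Rgas F by rewrite mulr_gt0// Rgas_gt0.
rewrite (_ : Pref R / (n * Rgas F * T) = Pref R / (n * Rgas F) / T); last first.
  by rewrite invfM mulrA.
rewrite [ln (_ / T)]ln_div ?posrE ?divr_gt0 ?Pref_gt0//.
by ring.
Qed.

Definition admissible : set R := [set n | 0 < n < (b_coef F)^-1].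

Lemma open_admissible : open admissible.
Proof.
rewrite (_ : admissible = [set n | 0 < n] `&` [set n | n < (b_coef F)^-1]).
  by apply: openI; [exact: open_gt|exact: open_lt].
by apply/seteqP; split => n /=; [move/andP|move=> [? ?]; apply/andP].
Qed.

Lemma Ck_real_configurational k : Ck_real k admissible configurational_part.
Proof.
have oA := open_admissible; have b0 := b_coef_gt0.
have Cid : Ck_real k admissible id by exact: sub_Ck_dir (@Ck_real_id R k).
apply: Ck_dirN => //; apply: Ck_dirZ => //; apply: Ck_dirM => //.
apply: Ck_dirD => //.
  apply: (@Ck_dir_comp _ _ _ _ _ _ (@positives R) _ _ oA _ _ (@Ck_real_ln R k)).
    move=> n /= /andP[n0 _]; rewrite /positives /=.
    by rewrite divr_gt0 ?Pref_gt0 ?mulr_gt0 ?Rgas_gt0.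
  apply: Ck_dirZ => //.
  apply: (@Ck_dir_comp _ _ _ _ _ _ [set x | x != 0] _ _ oA _ _ (@Ck_real_inv R k)).
    by move=> n /= /andP[n0 _]; rewrite mulf_neq0 ?lt0r_neq0 ?Rgas_gt0.
  by smooth.
apply: (@Ck_dir_comp _ _ _ _ _ _ (@positives R) _ _ oA _ _ (@Ck_real_ln R k)).
  move=> n /= /andP[n0 nb]; rewrite /positives /= subr_gt0 mulrC.
  by rewrite -ltr_pdivlMr// div1r.
by smooth.
Qed.

Lemma Ck_real_attraction k : Ck_real k admissible attraction_part.
Proof.
have oA := open_admissible; have b0 := b_coef_gt0.
have Cid : Ck_real k admissible id by exact: sub_Ck_dir (@Ck_real_id R k).
(* With [0 < b n < 1], the bound [sqrt 2 < 2] gives [(1 - sqrt 2) b n > - b n > -1], so the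
   numerator of the quotient stays positive. *)
have s2 : Num.sqrt 2 < 2 :> R.
  by rewrite -[ltRHS](@ger0_norm R)// -sqrtr_sqr ltr_sqrt ?exprn_gt0//; lra.
have s0 : 0 < Num.sqrt 2 :> R by rewrite sqrtr_gt0.
have bn1 n : admissible n -> 0 < b_coef F * n < 1.
  by move=> /andP[n0 nb]; rewrite mulr_gt0//= mulrC -ltr_pdivlMr// div1r.
have num_gt0 n : admissible n -> 0 < 1 + (1 - Num.sqrt 2) * b_coef F * n.
  by move=> /bn1; rewrite -mulrA => /andP[]; nra.
have den_gt0 n : admissible n -> 0 < 1 + (1 + Num.sqrt 2) * b_coef F * n.
  by move=> /bn1; rewrite -mulrA => /andP[]; nra.
apply: Ck_dirM => //; first by smooth.
apply: (@Ck_dir_comp _ _ _ _ _ _ (@positives R) _ _ oA _ _ (@Ck_real_ln R k)).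
  by move=> n An; rewrite /positives /= divr_gt0 ?num_gt0 ?den_gt0.
apply: Ck_dirM => //; first by smooth.
apply: (@Ck_dir_comp _ _ _ _ _ _ [set x | x != 0] _ _ oA _ _ (@Ck_real_inv R k)).
  by move=> n An /=; rewrite lt0r_neq0 ?den_gt0.
by smooth.
Qed.

Lemma Ck_real_a_coef k : Ck_real k (@positives R) (a_coef F).
Proof.
have oP := @open_positives R.
have Cid : Ck_real k (@positives R) id by exact: sub_Ck_dir (@Ck_real_id R k).
have Csqrt : Ck_real k (@positives R) (fun T => Num.sqrt (T / Tcrit F)).
  apply: (@Ck_dir_comp _ _ _ _ _ _ (@positives R) _ _ oP _ _ (@Ck_real_sqrt R k)).
    by move=> T T0; rewrite /positives /= divr_gt0 ?Tcrit_gt0.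
  by smooth.
by rewrite /a_coef; smooth.
Qed.

Lemma Ck_real_c_infl k : Ck_real k (@positives R) (c_infl F).
Proof.
have oP := @open_positives R.
have Cid : Ck_real k (@positives R) id by exact: sub_Ck_dir (@Ck_real_id R k).
have Ca := Ck_real_a_coef k.
by rewrite /c_infl; smooth.
Qed.

Lemma Ck_real_thermal k : Ck_real k (@positives R) thermal_part.
Proof.
have oP := @open_positives R.
have Cid l : Ck_real l (@positives R) id by exact: sub_Ck_dir (@Ck_real_id R l).
have Cpsi l : Ck_real l (@positives R) (fun t => psi_p F t / t).
  have Cl := Cid l; apply: Ck_dirM => //; first by rewrite /psi_p; smooth.
  by apply: (sub_Ck_dir _ (@Ck_real_inv R l)) => t t0 /=; exact: lt0r_neq0.
(* The integrand [psi_p / t] is smooth for positive [t], so its integral is one order smoother than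
   asked and is then weakened. *)
have Coint : Ck_real k (@positives R)
    (fun T => oint (Tref R) T (fun t => psi_p F t / t)).
  have doint T : positives T -> is_derive T 1
      (fun T => oint (Tref R) T (fun t => psi_p F t / t)) (psi_p F T / T).
    move=> T0; apply: (@is_derive_oint _ (fun t => psi_p F t / t)) => //.
      by move=> t t0; exact: (Ck_dir_cont (Cpsi 0%N)).
    exact: Tref_gt0.
  by apply: Ck_dirW; exact: (Ck_realS oP doint (Cpsi k)).
have Ck := Cid k; have Cln := @Ck_real_ln R k.
by rewrite /thermal_part; smooth.
Qed.

Lemma f_bulk_dTE n T : 0 < n -> 0 < T ->
  f_bulk_dT F n T = n * derive1 thermal_part T + configurational_part n
                    + derive1 (a_coef F) T * attraction_part n.
Proof.
move=> n0 T0.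
have [_ /(_ tt)[dth _]] := Ck_real_thermal 1.
have [_ /(_ tt)[da _]] := Ck_real_a_coef 1.
have dth' := derivableP (dth T T0); have da' := derivableP (da T T0).
(* The separated form holds for positive temperatures only, which is a neighbourhood of [T]; [G]
   writes it with scalings to meet the linearity rules of derivatives. *)
pose G (t : R) : R := n *: thermal_part t + configurational_part n *: t
                      + attraction_part n *: a_coef F t.
rewrite /f_bulk_dT derive1E (@near_eq_derive _ _ _ _ G); last first.
  apply: (near_open (@open_positives R)) => // t /= t0.
  by rewrite f_bulkE// /G; congr (_ + _ + _); exact: mulrC.
have -> := @derive_val _ _ _ _ _ _ _ (is_deriveD (is_deriveD (is_deriveZ n dth')
   (is_deriveZ (configurational_part n) (is_derive_id T (1 : R))))
   (is_deriveZ (attraction_part n) da')).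
by rewrite !derive1E; congr (_ + _ + _); [exact: mulr1|exact: mulrC].
Qed.

Section CkDir.
Variables (V : normedModType R) (I : Type) (e : I -> V) (k : nat) (U : set V).
Variables (n T : V -> R).
Hypotheses (oU : open U) (nU : forall x, U x -> admissible (n x))
  (TU : forall x, U x -> 0 < T x)
  (Cn : Ck_dir e k U n) (CT : Ck_dir e k U T).

Lemma Ck_dir_f_bulk : Ck_dir e k U (fun x => f_bulk F (n x) (T x)).
Proof.
pose G x := n x * thermal_part (T x) + T x * configurational_part (n x)
             + a_coef F (T x) * attraction_part (n x).
apply: (@eq_Ck_dir _ _ _ _ _ _ G) => //.
  by move=> x Ux; rewrite f_bulkE ?TU//; have /andP[] := nU Ux.
apply: Ck_dirD => //; last first.
  apply: Ck_dirM => //; first exact: Ck_dir_comp TU CT (Ck_real_a_coef k).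
  exact: Ck_dir_comp nU Cn (Ck_real_attraction k).
apply: Ck_dirD => //; apply: Ck_dirM => //.
  exact: Ck_dir_comp TU CT (Ck_real_thermal k).
exact: Ck_dir_comp nU Cn (Ck_real_configurational k).
Qed.

Lemma Ck_dir_f_bulk_dT : Ck_dir e k U (fun x => f_bulk_dT F (n x) (T x)).
Proof.
pose G x := n x * derive1 thermal_part (T x) + configurational_part (n x)
             + derive1 (a_coef F) (T x) * attraction_part (n x).
apply: (@eq_Ck_dir _ _ _ _ _ _ G) => //.
  by move=> x Ux; rewrite f_bulk_dTE ?TU//; have /andP[] := nU Ux.
apply: Ck_dirD => //; last first.
  apply: Ck_dirM => //.
    exact: Ck_dir_comp TU CT (Ck_real_derive (Ck_real_a_coef k.+1)).
  exact: Ck_dir_comp nU Cn (Ck_real_attraction k).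
apply: Ck_dirD => //; last exact: Ck_dir_comp nU Cn (Ck_real_configurational k).
apply: Ck_dirM => //.
exact: Ck_dir_comp TU CT (Ck_real_derive (Ck_real_thermal k.+1)).
Qed.

End CkDir.
End EquationOfState.

(** * A [C^1] cutoff of a compact set *)

Section Cutoff.
Variable R : realType.

(** This is the square of the positive part of [s]. Its derivative, twice the positive part, is
    continuous, and [C^1] is all that the divergence theorem asks for. *)
Definition sqr_pos (s : R) : R := 2^-1 * (s ^+ 2 + s * `|s|).

Lemma sqr_pos_le0 s : s <= 0 -> sqr_pos s = 0.
Proof. by move=> s0; rewrite /sqr_pos ler0_norm// mulrN expr2 subrr mulr0. Qed.

Lemma Ck_real_sqr_pos : Ck_real 1 setT sqr_pos.
Proof.
have Cid k : Ck_real k setT (@id R) by exact: Ck_real_id.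
have Cnorm : Ck_real 0 setT (fun s : R => 2 * `|s|).
  by split => // s _; apply: cvgM; [exact: cvg_cst|exact: norm_continuous].
have dM (s : R) : setT s -> is_derive s 1 (fun s : R => s * `|s|) (2 * `|s|).
  move=> _; have sqr_derive : is_derive s 1 (fun s : R => s * s) (2 * s).
    have := is_deriveM (is_derive_id s (1 : R)) (is_derive_id s (1 : R)).
    by rewrite /GRing.scale /= mulr1 -[s + s]mulr2n mulr_natl.
  have [s0|s0|->] := ltgtP s 0.
  - rewrite ltr0_norm// mulrN; have := is_deriveN sqr_derive.
    apply: near_eq_is_derive; apply: (near_open (@open_lt R 0)) => // t /= t0.
    by rewrite ltr0_norm// mulrN.
  - rewrite gtr0_norm//; move: sqr_derive.
    apply: near_eq_is_derive; apply: (near_open (@open_gt R 0)) => // t /= t0.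
    by rewrite gtr0_norm.
  (* At the origin the difference quotient of [s |s|] is [|h|], which tends to [0]. *)
  - rewrite (@normr0 R R) mulr0; pose f (s : R) : R := s * `|s|.
    have lim0 : h^-1 *: ((f \o shift 0) (h *: (1 : R)) - f 0)
        @[h --> (0 : R)^'] --> (0 : R).
      apply: (@cvg_trans _ ((fun h : R => `|h|) @ (0 : R)^')); last first.
        have := @norm_continuous _ R^o 0; rewrite /continuous_at normr0.
        exact: cvg_within_filter.
      apply: near_eq_cvg; near=> h.
      rewrite /f /= mul0r subr0 addr0 /GRing.scale /= mulr1 mulKf//.
      by near: h; exact: nbhs_dnbhs_neq.
    split; first by apply/cvg_ex; exists 0.
    exact: cvg_lim lim0.
have CM : Ck_real 1 setT (fun s : R => s * `|s|) by exact: (Ck_realS openT dM).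
have Ci := Cid 1; have oT := @openT R.
rewrite /sqr_pos; apply: (Ck_dirZ _ oT); apply: (Ck_dirD oT _ CM).
exact: (Ck_dirX 2 oT Ci).
Unshelve. all: by end_near. Qed.

(** For [|t| <= 1] the inner square vanishes and the value is [1]; for [|t| >= 2] it is at least
    [9], so the outer argument is negative and the value is [0]. *)
Definition plateau (t : R) : R := sqr_pos (1 - sqr_pos (t ^+ 2 - 1)).

Lemma Ck_real_plateau : Ck_real 1 setT plateau.
Proof.
have Cid : Ck_real 1 setT (@id R) by exact: Ck_real_id.
have oT := @openT R; have Cs := Ck_real_sqr_pos.
have Cin : Ck_real 1 setT (fun t : R => t ^+ 2 - 1).
  exact: (Ck_dirB oT (Ck_dirX 2 oT Cid) (Ck_dir_cst _ _ _ _)).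
have Cmid : Ck_real 1 setT (fun t : R => sqr_pos (t ^+ 2 - 1)).
  exact: (Ck_dir_comp oT _ Cin Cs).
have Cout : Ck_real 1 setT (fun t : R => 1 - sqr_pos (t ^+ 2 - 1)).
  exact: (Ck_dirB oT (Ck_dir_cst _ _ _ _) Cmid).
exact: (Ck_dir_comp oT _ Cout Cs).
Qed.

Lemma plateau1 t : `|t| <= 1 -> plateau t = 1.
Proof.
move=> t1; rewrite /plateau [sqr_pos (t ^+ 2 - 1)]sqr_pos_le0; last first.
  by rewrite subr_le0 -real_normK ?num_real// expr_le1.
by rewrite subr0 /sqr_pos normr1; lra.
Qed.

Lemma plateau0 t : 2 <= `|t| -> plateau t = 0.
Proof.
move=> t2; rewrite /plateau sqr_pos_le0//.
have t4 : 4 <= t ^+ 2 by rewrite -real_normK ?num_real//; nra.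
rewrite /sqr_pos ger0_norm; last by lra.
by nra.
Qed.

Variable d : nat.
Local Notation V := 'rV[R]_d.
Local Notation axes := (fun i : 'I_d => delta_mx 0 i : V).

Lemma CkE k (U : set V) f : Ck k U f <-> Ck_dir axes k U f.
Proof.
elim: k f => [|k IH] f; first by [].
by split=> -[fc fd]; split => // i; have [fi fI] := fd i; split => //; exact/IH.
Qed.

Lemma Ck_dir_coord k (U : set V) i : Ck_dir axes k U (fun x => x 0 i).
Proof.
have dxi (x : V) v : is_derive x v (fun y : V => y 0 i) (v 0 i).
  have did := @derivable_id _ V x v.
  split; first by have /derivable_mxP := did; exact.
  by have := derive_mx did; rewrite derive_id => /matrixP/(_ 0 i); rewrite mxE.
have cxi x : U x -> {for x, continuous (fun x : V => x 0 i)}.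
  by move=> _; exact: coord_continuous.
case: k => [|k]; first by split.
split => // j; split; first by move=> x _; have [] := dxi x (axes j).
have -> : (fun x : V => 'D_(axes j) (fun y : V => y 0 i) x) = (fun=> axes j 0 i).
  by apply/funext => x; have [_ ->] := dxi x (axes j).
exact: Ck_dir_cst.
Qed.

(** Balls of the sup norm are cubes, so a product of one-variable plateaus separates [ball c r] from
    the complement of [ball c (2 * r)]. *)
Definition bump (c : V) (r : R) (x : V) : R :=
  \prod_(i < d) plateau (r^-1 * (x 0 i - c 0 i)).

Lemma Ck_dir_bump c r : Ck_dir axes 1 setT (bump c r).
Proof.
have oT := @openT V; apply: (Ck_dir_prod _ oT) => i _.
have Ci : Ck_dir axes 1 setT (fun x : V => r^-1 * (x 0 i - c 0 i)).
  apply: (Ck_dirZ _ oT); apply: (Ck_dirB oT); last exact: Ck_dir_cst.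
  exact: Ck_dir_coord.
exact: (Ck_dir_comp oT _ Ci Ck_real_plateau).
Qed.

Lemma bump1 c r x : 0 < r -> ball c r x -> bump c r x = 1.
Proof.
move=> r0 [_ cx]; rewrite /bump big1// => i _; rewrite plateau1//.
have := cx 0 i; rewrite /ball /= distrC => xi.
by rewrite normrM gtr0_norm ?invr_gt0// ler_pdivrMl// mulr1 ltW.
Qed.

Lemma bump_neq0 c r x : 0 < r -> bump c r x != 0 -> ball c (2 * r) x.
Proof.
move=> r0 /prodf_neq0 b0; split; first by rewrite mulr_gt0.
move=> i j; rewrite (ord1 i) /ball /= distrC ltNge; apply/negP => rj.
have := b0 j isT; rewrite plateau0 ?eqxx//.
by rewrite normrM gtr0_norm ?invr_gt0// ler_pdivlMl// mulrC.
Qed.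

Lemma compact_closed_ball_rV (c : V) r : 0 < r -> compact (closed_ball c r).
Proof.
move=> r0; apply: bounded_closed_compact; last exact: closed_ball_closed.
exists (`|c| + r); split; first exact: num_real.
move=> M cM x; rewrite closed_ballE// /closed_ball_ /= => cx.
apply: le_trans (ltW cM); rewrite -[x](subKr c).
by apply: (le_trans (ler_normB _ _)); rewrite lerD2l.
Qed.

Lemma C1_cutoff (K U : set V) : compact K -> open U -> K `<=` U ->
  exists (chi : V -> R) (S : set V),
    [/\ Ck_dir axes 1 setT chi, compact S, S `<=` U,
        (forall x, K x -> chi x = 1) & (forall x, ~ S x -> chi x = 0)].
Proof.
move=> cK oU KU.
(* The factor [3] leaves room: the bump at [c] vanishes off a ball of radius [2 r], whose closure
   lies in the open ball of radius [3 r]. Outside [U] the radius [1] is a default. *)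
have radius (c : V) : exists r : R, 0 < r /\ (U c -> ball c (3 * r) `<=` U).
  have [Uc|nUc] := pselect (U c); last by exists 1.
  have /nbhs_ballP[r r0 rU] : nbhs c U by exact: open_nbhs_nbhs.
  exists (r / 3); split; first exact: divr_gt0.
  by move=> _; rewrite mulrC divfK.
have [r r_ball] := choice radius.
have r0 c : 0 < r c by case: (r_ball c).
have rU c : U c -> ball c (3 * r c) `<=` U by case: (r_ball c).
have covK : cover_compact K by rewrite -compact_cover.
case: (covK V K (fun c => ball c (r c))); [by move=> c _; exact: ball_open| |].
  by move=> x Kx; exists x => //; exact: ballxx.
move=> D0 D0K KD0; pose D : seq V := finmap.enum_fset D0.
have DK c : c \in D -> K c by move=> /D0K; rewrite inE.
have KD x : K x -> exists2 c, c \in D & ball c (r c) x.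
  by move=> /KD0[c /= cD cx]; exists c.
(* On each ball of the subcover one factor of the product vanishes, so the value is [1] on [K];
   where all bumps vanish it is [0]. *)
exists (fun x => 1 - \prod_(c <- D) (1 - bump c (r c) x)).
exists (\big[setU/set0]_(c <- D) closed_ball c (2 * r c)).
have inS x c : c \in D -> closed_ball c (2 * r c) x ->
    (\big[setU/set0]_(c <- D) closed_ball c (2 * r c)) x.
  by move=> cD cx; rewrite -bigcup_seq; exists c.
have oT := @openT V; split.
- apply: (Ck_dirB oT); first exact: Ck_dir_cst.
  apply: (Ck_dir_prod _ oT) => c _; apply: (Ck_dirB oT); first exact: Ck_dir_cst.
  exact: Ck_dir_bump.
- apply: bigsetU_compact => c _; apply: compact_closed_ball_rV.
  by rewrite mulr_gt0.
- move=> x; rewrite -bigcup_seq => -[c /= cD cx]; apply: (rU c).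
    by apply: KU; exact: DK.
  apply: closed_ball_subset cx; first by rewrite mulr_gt0.
  by rewrite ltr_pM2r// ltr_nat.
- move=> x /KD[c cD cx]; rewrite (big_rem c)//= bump1// subrr mul0r.
  exact: subr0.
- move=> x nSx; rewrite big_seq big1 ?subrr// => c cD.
  have [->|bx] := eqVneq (bump c (r c) x) 0; first exact: subr0.
  exfalso; apply: nSx; apply: (inS _ _ cD).
  by apply: subset_closed_ball; exact: bump_neq0.
Qed.

(** [chi] times [G] is [C^1] on [U] by the product rule and vanishes on the open complement of [S];
    these two sets cover the space, so the values of [G] off [U] are harmless. *)
Lemma C1_compact_extension (K U : set V) (G : V -> V) :
  compact K -> open U -> K `<=` U ->
  (forall i, Ck_dir axes 1 U (fun x => G x 0 i)) ->
  exists2 H : V -> V, C1_compact_support H & forall x, K x -> H x = G x.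
Proof.
move=> cK oU KU CG.
have [chi [S [Cchi cS SU chi1 chi0]]] := C1_cutoff cK oU KU.
have clS : closed S := compact_closed (@norm_hausdorff _ _) cS.
exists (fun x => chi x *: G x); last by move=> x /chi1 ->; rewrite scale1r.
split; last first.
  apply: (subclosed_compact _ cS); first exact: closed_closure.
  rewrite closureE; apply: smallest_sub => // x /= /eqP Gx.
  by apply: contrapT => /chi0 chix; apply: Gx; rewrite chix scale0r.
move=> i; apply/CkE; have -> : [set: V] = U `|` ~` S.
  apply/esym; rewrite -subTset => x _.
  by have [Sx|nSx] := pselect (S x); [left; exact: SU|right].
apply: Ck_dirU.
  apply: (@eq_Ck_dir _ _ _ _ _ _ (fun x => chi x * G x 0 i)) => //.
    by move=> x _; rewrite mxE.
  by apply: (Ck_dirM oU) (CG i); exact: sub_Ck_dir Cchi.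
apply: (@eq_Ck_dir _ _ _ _ _ _ (fun=> 0)).
- exact: closed_openC.
- by move=> x /chi0 chix; rewrite mxE chix mul0r.
- exact: Ck_dir_cst.
Qed.

End Cutoff.

(** * Integrals over the domain and its boundary *)

Section RowIntegration.
Variables (R : realType) (d : nat).
Local Notation V := 'rV[R]_d.
Local Notation axes := (fun i : 'I_d => delta_mx 0 i : V).
Implicit Types (Omega U : set V) (f : V -> R).

Lemma measurable_open_rvec U : open U -> measurable (U : set (rvec R d)).
Proof. by move=> oU; exact: sub_sigma_algebra. Qed.

Lemma measurable_closed_rvec U : closed U -> measurable (U : set (rvec R d)).
Proof.
move=> cU; rewrite -[U]setCK; apply: measurableC.
by apply: measurable_open_rvec; exact: closed_openC.
Qed.

Lemma measurable_boundary Omega : open Omega ->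
  measurable (boundary Omega : set (rvec R d)).
Proof.
move=> oO; apply: measurableD.
  by apply: measurable_closed_rvec; exact: closed_closure.
by apply: measurable_open_rvec; exact: open_interior.
Qed.

Lemma measurable_fun_continuous_rvec U f : open U ->
  (forall x, U x -> {for x, continuous f}) ->
  measurable_fun (U : set (rvec R d)) f.
Proof.
move=> oU cf; apply: (measurability _ (RGenOpens.measurableE R)).
move=> _ [_ [a [b ->] <-]]; apply: measurable_open_rvec.
rewrite openE => x [Ux fx]; rewrite /interior; apply: filterI.
  exact: open_nbhs_nbhs.
by apply: (cf x Ux); apply: open_nbhs_nbhs; split => //; exact: interval_open.
Qed.

Lemma lebesgue_rV_bounded Omega : open Omega -> bounded_set Omega ->
  (@lebesgue_rV R d Omega < +oo)%E.
Proof.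
(* Boundedness by [M] is a bound by every number strictly above [M], hence a cube of half-side
   [M + 1]. *)
move=> oO [M [_ /(_ (M + 1))]]; rewrite ltrDl ltr01 => /(_ isT) OM.
pose A (i : 'I_d) : set (measurableTypeR R) := `[- (M + 1), M + 1]%classic.
pose B : set V := [set x | forall i, A i (x 0 i)].
have OB : Omega `<=` B.
  move=> x /OM xM i; rewrite /A /= in_itv/= -ler_norml; apply: le_trans xM.
  rewrite [leRHS]/Num.Def.normr/= mx_normrE.
  exact: (@le_bigmax _ _ _ _ (fun ij : 'I_1 * 'I_d => `|x ij.1 ij.2|) (0, i)).
have mA i : measurable (A i) by exact: measurable_itv.
have cB : closed B.
  rewrite (_ : B = \bigcap_(i in [set: 'I_d]) [set x | A i (x 0 i)]).
    apply: closed_bigI => i _.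
    apply: (preimage_closed (f := fun x : V => x 0 i)); last exact: itv_closed.
    by move=> x _; exact: coord_continuous.
  by apply/seteqP; split => x Bx i; [move=> _|]; exact: Bx.
apply: (@le_lt_trans _ _ (@lebesgue_rV R d B)).
  by apply: le_measure => //; rewrite inE;
    [exact: measurable_open_rvec|exact: measurable_closed_rvec].
rewrite lebesgue_rV_box//.
rewrite (eq_bigr (fun=> lebesgue_measure (`[- (M + 1), M + 1]%classic : set R))) => [|//].
rewrite lebesgue_measure_itv /=; case: ifP => _.
  by rewrite prodEFin ltry.
by rewrite prodEFin ltry.
Qed.

Lemma compact_closure_bounded Omega : bounded_set Omega -> compact (closure Omega).
Proof.
move=> [M [Mr OM]]; apply: bounded_closed_compact; last exact: closed_closure.
exists M; split => // N MN x.
have /closure_id ballE := @closed_closed_ball_ R V 0 N.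
have sub : Omega `<=` closed_ball_ Num.norm (0 : V) N.
  by move=> y Oy; rewrite /closed_ball_ /= sub0r normrN; exact: OM.
by move=> /(closureS sub); rewrite -ballE /closed_ball_ /= sub0r normrN.
Qed.

Lemma integrable_continuous_rvec Omega U f : open Omega -> bounded_set Omega ->
  open U -> closure Omega `<=` U -> (forall x, U x -> {for x, continuous f}) ->
  (@lebesgue_rV R d).-integrable Omega (EFin \o f).
Proof.
move=> oO bO oU OU cf.
have cO := compact_closure_bounded bO.
apply: measurable_bounded_integrable.
- exact: measurable_open_rvec.
- exact: lebesgue_rV_bounded oO bO.
- apply: (measurable_funS (measurable_open_rvec oU)).
    by apply: subset_trans OU; exact: subset_closure.
  exact: measurable_fun_continuous_rvec.
- have /compact_bounded[M [Mr fM]] : compact (f @` closure Omega).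
    apply: continuous_compact cO; apply: continuous_in_subspaceT => x.
    by rewrite inE => /OU; exact: cf.
  exists M; split => // N MN x Ox; apply: fM => //.
  by exists x => //; exact: subset_closure.
Qed.

Section Surface.
Variables (Omega : set V) (sigma : {finite_measure set (rvec R d) -> \bar R}).
Variable nu : V -> V.
Hypotheses (oO : open Omega) (bO : bounded_set Omega).
Hypothesis nuO : outward_normal Omega sigma nu.

Lemma eq_divg (G H : V -> V) x : Omega x ->
  (forall y, Omega y -> G y = H y) -> divg G x = divg H x.
Proof.
move=> Ox GH; apply: eq_bigr => i _; apply: near_eq_derive.
by apply: (near_open oO Ox) => y Oy; rewrite GH.
Qed.

Lemma divergence_theorem U (G : V -> V) : open U -> closure Omega `<=` U ->
  (forall i, Ck_dir axes 1 U (fun x => G x 0 i)) ->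
  \int[@lebesgue_rV R d]_(x in Omega) divg G x =
  \int[sigma]_(x in boundary Omega) dotv (G x) (nu x).
Proof.
move=> oU OU CG; have [_ _ _ div] := nuO.
have [H CH HG] := C1_compact_extension (compact_closure_bounded bO) oU OU CG.
transitivity (\int[@lebesgue_rV R d]_(x in Omega) divg H x).
  apply: eq_Rintegral => x; rewrite inE => Ox; apply: eq_divg => // y Oy.
  by rewrite HG//; exact: subset_closure.
rewrite div//; apply: eq_Rintegral => x; rewrite inE => -[Bx _].
by rewrite HG.
Qed.

Lemma sub_ae (P Q : V -> Prop) : (forall x, P x -> Q x) ->
  {ae sigma, forall x, P x} -> {ae sigma, forall x, Q x}.
Proof.
move=> PQ; apply: (@filterS _ _ (ae_filter_ringOfSetsType sigma)) => x; exact: PQ.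
Qed.

(** The condition on [grad n1 . nu] holds only up to [sigma]-null sets, so the integrands are
    compared almost everywhere, which requires them to be measurable; continuity near the closure
    and measurability of [nu] provide this. *)
Lemma eq_surface_integral U (G H : V -> V) : open U -> closure Omega `<=` U ->
  (forall i x, U x -> {for x, continuous (fun x => G x 0 i)}) ->
  (forall i x, U x -> {for x, continuous (fun x => H x 0 i)}) ->
  {ae sigma, forall x, boundary Omega x ->
     dotv (G x) (nu x) = dotv (H x) (nu x)} ->
  \int[sigma]_(x in boundary Omega) dotv (G x) (nu x) =
  \int[sigma]_(x in boundary Omega) dotv (H x) (nu x).
Proof.
move=> oU OU cG cH GH; have [mnu _ _ _] := nuO.
have mB := measurable_boundary oO.
have mdot (K : V -> V) :
    (forall i x, U x -> {for x, continuous (fun x => K x 0 i)}) ->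
    measurable_fun (boundary Omega : set (rvec R d)) 
      (fun x : rvec R d => dotv (K x) (nu x) : R).
  move=> cK; apply: measurable_sum => i.
  apply: measurable_funM.
    apply: (measurable_funS (measurable_open_rvec oU)).
      by move=> x [/OU].
    exact: (measurable_fun_continuous_rvec oU (cK i)).
  exact: measurable_funS (mnu i).
rewrite /Rintegral; congr fine; apply: ae_eq_integral => //.
- by apply/measurable_EFinP; exact: mdot.
- by apply/measurable_EFinP; exact: mdot.
- by move: GH; apply: sub_ae => x GHx Bx; rewrite GHx.
Qed.

End Surface.
End RowIntegration.

(** * Identities of vector calculus *)

Section VectorIdentities.
Variables (R : realType) (d : nat).
Local Notation V := 'rV[R]_d.
Local Notation axes := (fun i : 'I_d => delta_mx 0 i : V).
Implicit Types (U : set V) (f g : V -> R) (F G u : V -> V).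

Definition Ckv_dir k U G := forall i, Ck_dir axes k U (fun x => G x 0 i).

Lemma Ck_dir_pd k U f i : Ck_dir axes k.+1 U f -> Ck_dir axes k U (pd i f).
Proof. by case=> _ /(_ i)[]. Qed.

Lemma Ckv_dir_grad k U f : Ck_dir axes k.+1 U f -> Ckv_dir k U (grad f).
Proof.
move=> Cf i; rewrite (_ : (fun x => _) = pd i f); first exact: Ck_dir_pd.
by apply/funext => x; rewrite mxE.
Qed.

Lemma Ck_dir_divg k U G : open U -> Ckv_dir k.+1 U G -> Ck_dir axes k U (divg G).
Proof. by move=> oU CG; apply: (Ck_dir_sum _ oU) => i _; exact: Ck_dir_pd. Qed.

Lemma Ck_dir_dotv k U F G : open U -> Ckv_dir k U F -> Ckv_dir k U G ->
  Ck_dir axes k U (fun x => dotv (F x) (G x)).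
Proof.
by move=> oU CF CG; apply: (Ck_dir_sum _ oU) => i _; exact: (Ck_dirM oU).
Qed.

Lemma Ckv_dirD k U F G : open U -> Ckv_dir k U F -> Ckv_dir k U G ->
  Ckv_dir k U (fun x => F x + G x).
Proof.
move=> oU CF CG i; apply: (eq_Ck_dir oU) (Ck_dirD oU (CF i) (CG i)) => x _.
by rewrite mxE.
Qed.

Lemma Ckv_dirN k U F : open U -> Ckv_dir k U F -> Ckv_dir k U (fun x => - F x).
Proof.
move=> oU CF i; apply: (eq_Ck_dir oU) (Ck_dirN oU (CF i)) => x _.
by rewrite mxE.
Qed.

Lemma Ckv_dirZ k U f F : open U -> Ck_dir axes k U f -> Ckv_dir k U F ->
  Ckv_dir k U (fun x => f x *: F x).
Proof.
move=> oU Cf CF i; apply: (eq_Ck_dir oU) (Ck_dirM oU Cf (CF i)) => x _.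
by rewrite mxE.
Qed.

Lemma dotvC (v w : V) : dotv v w = dotv w v.
Proof. by apply: eq_bigr => i _; rewrite mulrC. Qed.

Lemma dotvDl (v1 v2 w : V) : dotv (v1 + v2) w = dotv v1 w + dotv v2 w.
Proof. by rewrite -big_split; apply: eq_bigr => i _; rewrite mxE mulrDl. Qed.

Lemma dotvZl a (v w : V) : dotv (a *: v) w = a * dotv v w.
Proof. by rewrite mulr_sumr; apply: eq_bigr => i _; rewrite mxE mulrA. Qed.

Lemma dotvNl (v w : V) : dotv (- v) w = - dotv v w.
Proof. by rewrite -scaleN1r dotvZl mulN1r. Qed.

Lemma dotvBl (v1 v2 w : V) : dotv (v1 - v2) w = dotv v1 w - dotv v2 w.
Proof. by rewrite dotvDl dotvNl. Qed.

Section AtPoint.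
Variables (U : set V) (x : V).
Hypotheses (oU : open U) (Ux : U x).

Lemma Ck_dir_derivable f : Ck_dir axes 1 U f ->
  forall i, derivable f x (axes i).
Proof. by case=> _ Df i; case: (Df i) => + _; exact. Qed.

Lemma pdM f g i : Ck_dir axes 1 U f -> Ck_dir axes 1 U g ->
  pd i (fun y => f y * g y) x = f x * pd i g x + g x * pd i f x.
Proof.
move=> /Ck_dir_derivable/(_ i) df /Ck_dir_derivable/(_ i) dg.
exact: (deriveM df dg).
Qed.

Lemma pdD f g i : Ck_dir axes 1 U f -> Ck_dir axes 1 U g ->
  pd i (fun y => f y + g y) x = pd i f x + pd i g x.
Proof.
move=> /Ck_dir_derivable/(_ i) df /Ck_dir_derivable/(_ i) dg.
exact: (deriveD df dg).
Qed.

Lemma pdN f i : Ck_dir axes 1 U f -> pd i (fun y => - f y) x = - pd i f x.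
Proof. by move=> /Ck_dir_derivable/(_ i) df; exact: (deriveN df). Qed.

Lemma pd_sum (J : Type) (s : seq J) (h : J -> V -> R) i :
  (forall j, Ck_dir axes 1 U (h j)) ->
  pd i (fun y => \sum_(j <- s) h j y) x = \sum_(j <- s) pd i (h j) x.
Proof.
move=> Ch; elim: s => [|j s IH].
  rewrite big_nil; have -> : (fun y => \sum_(j <- [::]) h j y) = (fun=> 0).
    by apply/funext => y; rewrite big_nil.
  exact: derive_cst.
rewrite big_cons -IH.
have Cs : Ck_dir axes 1 U (fun y => \sum_(j <- s) h j y).
  by apply: (Ck_dir_sum _ oU) => l _.
rewrite -(pdD i (Ch j) Cs); congr (pd _ _ _); apply/funext => y.
by rewrite big_cons.
Qed.

Lemma divgD F G : Ckv_dir 1 U F -> Ckv_dir 1 U G ->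
  divg (fun y => F y + G y) x = divg F x + divg G x.
Proof.
move=> CF CG; rewrite /divg -big_split; apply: eq_bigr => i _ /=.
have -> : (fun y => (F y + G y) 0 i) = fun y => F y 0 i + G y 0 i.
  by apply/funext => y; rewrite mxE.
exact: pdD (CF i) (CG i).
Qed.

Lemma divgN F : Ckv_dir 1 U F -> divg (fun y => - F y) x = - divg F x.
Proof.
move=> CF; rewrite /divg -sumrN; apply: eq_bigr => i _ /=.
have -> : (fun y => (- F y) 0 i) = fun y => - F y 0 i.
  by apply/funext => y; rewrite mxE.
exact: pdN (CF i).
Qed.

Lemma divgZ f F : Ck_dir axes 1 U f -> Ckv_dir 1 U F ->
  divg (fun y => f y *: F y) x = dotv (grad f x) (F x) + f x * divg F x.
Proof.
move=> Cf CF; rewrite /divg mulr_sumr -big_split; apply: eq_bigr => i _ /=.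
rewrite mxE mulrC addrC -(pdM i Cf (CF i)); congr (pd _ _ _).
by apply/funext => y; rewrite mxE.
Qed.

(** The convective term tested with [u] is half the derivative of [|u|^2] along [v]; with the
    continuity equation it becomes a flux of kinetic energy. *)
Lemma grad_dotv u v : Ckv_dir 1 U u ->
  dotv (grad (fun y => dotv (u y) (u y)) x) v = 2 * dotv (v *m gradv u x) (u x).
Proof.
move=> Cu.
have -> : dotv (v *m gradv u x) (u x) =
    \sum_(i < d) \sum_(j < d) v 0 i * pd i (fun y => u y 0 j) x * u x 0 j.
  rewrite exchange_big; apply: eq_bigr => j _ /=; rewrite mxE mulr_suml.
  by apply: eq_bigr => i _; rewrite mxE.
rewrite mulr_sumr; apply: eq_bigr => i _.
have Cuu j : Ck_dir axes 1 U (fun y => u y 0 j * u y 0 j) by exact: (Ck_dirM oU).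
rewrite mxE [pd i _ x](pd_sum _ _ Cuu) mulr_suml mulr_sumr.
by apply: eq_bigr => j _; rewrite (pdM i (Cu j) (Cu j)); ring.
Qed.

(** Power of a stress [A]: the work of its divergence plus the dissipation [A : grad u] is the
    divergence of the vector with components [sum_j u_j A_ij], hence the transpose. *)
Lemma divg_mulmx_tr u (A : V -> 'M[R]_d) : Ckv_dir 1 U u ->
  (forall i j, Ck_dir axes 1 U (fun y => A y i j)) ->
  divg (fun y => u y *m (A y)^T) x =
  dotv (divm A x) (u x) + ddot (A x) (gradv u x).
Proof.
move=> Cu CA.
have -> : dotv (divm A x) (u x) =
    \sum_(i < d) \sum_(j < d) pd i (fun y => A y i j) x * u x 0 j.
  by rewrite exchange_big; apply: eq_bigr => j _; rewrite mxE mulr_suml.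
rewrite /ddot -big_split; apply: eq_bigr => i _ /=; rewrite -big_split /=.
have -> : (fun y => (u y *m (A y)^T) 0 i) = fun y => \sum_j u y 0 j * A y i j.
  by apply/funext => y; rewrite mxE; apply: eq_bigr => j _; rewrite mxE.
have CuA j : Ck_dir axes 1 U (fun y => u y 0 j * A y i j) by exact: (Ck_dirM oU).
rewrite (pd_sum _ _ CuA); apply: eq_bigr => j _.
by rewrite mxE (pdM i (Cu j) (CA i j)) [_ * u x 0 j]mulrC.
Qed.

End AtPoint.
End VectorIdentities.

(** * Common neighbourhoods of the closure *)

Section Closures.
Variables (R : realType) (d : nat).
Local Notation V := 'rV[R]_d.
Local Notation axes := (fun i : 'I_d => delta_mx 0 i : V).
Implicit Types (U Omega : set V) (f : V -> R) (F : V -> V).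

Lemma open_setI_preimage U f (D : set R) : open U -> open D ->
  (forall x, U x -> {for x, continuous f}) -> open (U `&` f @^-1` D).
Proof.
move=> oU oD cf; rewrite openE => x [Ux Dfx]; rewrite /interior; apply: filterI.
  exact: open_nbhs_nbhs.
by apply: (cf x Ux); exact: open_nbhs_nbhs.
Qed.

Lemma Ck_closureE k Omega f : Ck_closure k Omega f <->
  exists U, [/\ open U, closure Omega `<=` U & Ck_dir axes k U f].
Proof.
by split=> -[U [oU OU Cf]]; exists U; split => //; exact/CkE.
Qed.

Lemma Ckv_closureE k Omega F : Ckv_closure k Omega F ->
  exists U, [/\ open U, closure Omega `<=` U & Ckv_dir k U F].
Proof.
move=> CF; have /choice[W HW] : forall i, exists U,
    [/\ open U, closure Omega `<=` U & Ck_dir axes k U (fun x => F x 0 i)].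
  by move=> i; apply/Ck_closureE; exact: CF.
exists (\big[setI/setT]_(i < d) W i); split.
- apply: (@big_ind _ open); [exact: openT|exact: openI|].
  by move=> i _; have [] := HW i.
- move=> x Ox; rewrite -bigcap_seq => i _; have [_ OW _] := HW i.
  exact: OW.
- move=> i; have [_ _ CFi] := HW i; apply: sub_Ck_dir CFi => x.
  rewrite -bigcap_seq; apply; exact: mem_index_enum.
Qed.

(** Asking [P] for all smaller open sets, and not for [U] alone, makes such statements stable under
    conjunction: many regularity hypotheses, each with its own neighbourhood, come to share one. *)
Definition near_closure Omega (P : set V -> Prop) := exists U,
  [/\ open U, closure Omega `<=` U & forall W, open W -> W `<=` U -> P W].

Lemma near_closureI Omega (P Q : set V -> Prop) : near_closure Omega P ->
  near_closure Omega Q -> near_closure Omega (fun W => P W /\ Q W).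
Proof.
move=> [A [oA OA PA]] [B [oB OB QB]]; exists (A `&` B); split.
- exact: openI.
- by move=> x Ox; split; [exact: OA|exact: OB].
- by move=> W oW WAB; split; [apply: PA|apply: QB] => // x /WAB[].
Qed.

Lemma near_closure_Ck k Omega f : Ck_closure k Omega f ->
  near_closure Omega (fun W => Ck_dir axes k W f).
Proof.
move=> /Ck_closureE[U [oU OU Cf]]; exists U; split => // W _ WU.
exact: sub_Ck_dir Cf.
Qed.

Lemma near_closure_Ckv k Omega F : Ckv_closure k Omega F ->
  near_closure Omega (fun W => Ckv_dir k W F).
Proof.
move=> /Ckv_closureE[U [oU OU CF]]; exists U; split => // W _ WU i.
exact: sub_Ck_dir (CF i).
Qed.

End Closures.

(** * The algebra of the energy balance at a point *)

Section FirstLaw.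
Variable R : realType.

(** Dictionary: [A], [B], [C], [S], [E], [Z] are [u1 . u1], [us . u1], [u0 . u1], [us . us],
    [u0 . us], [u0 . u0]; [X] is [(us . grad u1) . u1] and [W] is [div (n0 us)]. [gmus], [gTs] and
    [gmu1], [gT1] are the gradients of [mu] and [T1] tested with [us] and with [u1]; [DV], [DL] are
    the viscous works, [ed], [ld] the dissipations, and [h3], [h4], [h5] the divergences of the
    entropy, heat and density-gradient fluxes. *)
Lemma discrete_energy_identity (M dt n0 n1 th0 th1 gam A B C S E Z W X : R)
    (m gmus gTs gmu1 gT1 DV DL h3 h4 h5 ed ld : R) :
  dt != 0 -> n0 * M != 0 ->
  (n1 - n0) / dt + W = 0 ->
  S = E - dt / (n0 * M) * (n0 * gmus - gam * gTs) ->
  B = C - dt / (n0 * M) * (n0 * gmu1 - gam * gT1) ->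
  n0 * M * (dt^-1 * (A - C) + X) = - (n0 * gmu1) + gam * gT1 + DV + DL ->
  (th1 - th0) / dt + h3 = - h4 - h5 - m * W - gam * gTs + ed + ld
    + (2 * dt)^-1 * (n0 * M * ((A - B - (B - S)) + (S - E - (E - Z)))) ->
  2^-1 * M * (2 * (n0 * X)) + 2^-1 * M * A * W + (n0 * gmus + m * W) + h3 + h4
    + h5 - (DV + ed) - (DL + ld)
  = - dt^-1 * (2^-1 * (n1 * M * A) + th1 - (2^-1 * (n0 * M * Z) + th0)).
Proof.
move=> dt0 r0 cont ES EB mom ener.
have /andP[n00 M0] : (n0 != 0) && (M != 0) by move: r0; rewrite mulf_eq0 negb_or.
have HS : n0 * M * (S - E) * dt^-1 = - (n0 * gmus - gam * gTs).
  by rewrite ES; field; rewrite ?dt0 ?n00 ?M0.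
have HB : n0 * M * (B - C) * dt^-1 = - (n0 * gmu1 - gam * gT1).
  by rewrite EB; field; rewrite ?dt0 ?n00 ?M0.
have HW : W = - ((n1 - n0) * dt^-1) by apply/eqP; rewrite -addr_eq0 addrC cont.
have h2 : (2 * dt)^-1 = 2^-1 * dt^-1 by rewrite invfM.
(* The continuity equation has to be multiplied by [M A], a product that linear arithmetic does not
   form. Once it is supplied and [dt^-1] is a variable, the rest is linear in the monomials. *)
have HWA : M * A * W = - (M * A * (n1 - n0) * dt^-1) by rewrite HW mulrN !mulrA.
rewrite h2 in ener; move: dt^-1 h2 HS HB HW HWA mom ener => k _ HS HB _ HWA mom ener.
by lra.
Qed.
End FirstLaw.

(** * Regularity of the entropy and energy densities *)

Section EnergyDensities.
Variables (R : realType) (F : fluid R) (d : nat).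
Local Notation V := 'rV[R]_d.
Local Notation axes := (fun i : 'I_d => delta_mx 0 i : V).
Variables (U : set V) (n T : V -> R).
Hypotheses (oU : open U) (nU : forall x, U x -> admissible F (n x))
  (TU : forall x, U x -> 0 < T x)
  (Cn : Ck_dir axes 2 U n) (CT : Ck_dir axes 2 U T).

Let Cgrad2 : Ck_dir axes 1 U (fun x => dotv (grad n x) (grad n x)).
Proof. by apply: (Ck_dir_dotv oU); exact: Ckv_dir_grad. Qed.

Let C1n := Ck_dirW Cn.
Let C1T := Ck_dirW CT.

(** The term in [|grad n|^2] consumes one of the two derivatives of [n], whence [C^1]. *)
Lemma Ck_dir_gamma : Ck_dir axes 1 U (gamma F n T).
Proof.
apply: (Ck_dirD oU); first exact: Ck_dir_f_bulk_dT.
apply: (Ck_dirM oU) Cgrad2; apply: (Ck_dirZ _ oU).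
exact: (Ck_dir_comp oU TU C1T (Ck_real_derive (Ck_real_c_infl F 2))).
Qed.

Lemma Ck_dir_internal_energy : Ck_dir axes 1 U (internal_energy F n T).
Proof.
apply: (Ck_dirD oU).
  apply: (Ck_dirD oU); first exact: Ck_dir_f_bulk.
  apply: (Ck_dirM oU) Cgrad2; apply: (Ck_dirZ _ oU).
  exact: (Ck_dir_comp oU TU C1T (Ck_real_c_infl F 1)).
by apply: (Ck_dirM oU C1T); apply: (Ck_dirN oU); exact: Ck_dir_gamma.
Qed.

End EnergyDensities.

(** * The total energy as one integral *)

Section TotalEnergy.
Variables (R : realType) (F : fluid R) (d : nat).
Local Notation V := 'rV[R]_d.
Local Notation axes := (fun i : 'I_d => delta_mx 0 i : V).

Lemma dotvBB (a b : V) :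
  dotv (a - b) (a - b) = dotv a a - dotv b a - (dotv b a - dotv b b).
Proof. by rewrite dotvBl !(dotvC _ (a - b)) !dotvBl (dotvC a b). Qed.

Lemma ddotZl c (A B : 'M[R]_d) : ddot (c *: A) B = c * ddot A B.
Proof.
rewrite mulr_sumr; apply: eq_bigr => i _; rewrite mulr_sumr.
by apply: eq_bigr => j _; rewrite mxE mulrA.
Qed.

Lemma divgZc U x c (G : V -> V) : U x -> Ckv_dir 1 U G ->
  divg (fun y => c *: G y) x = c * divg G x.
Proof.
move=> Ux CG; rewrite mulr_sumr; apply: eq_bigr => i _.
have dG := Ck_dir_derivable Ux (CG i).
have -> : (fun y => (c *: G y) 0 i) = c \*: (fun y => G y 0 i).
  by apply/funext => y; rewrite mxE.
exact: deriveZ.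
Qed.

Definition energy_density (n T : V -> R) (u : V -> V) x : R :=
  2^-1 * (mass_density F n x * dotv (u x) (u x)) + internal_energy F n T x.

Variables (Omega U : set V).
Hypotheses (oO : open Omega) (bO : bounded_set Omega) (oU : open U)
  (OU : closure Omega `<=` U).

Lemma total_energyE (n T : V -> R) (u : V -> V) :
  Ck_dir axes 1 U n -> Ckv_dir 1 U u -> Ck_dir axes 1 U (internal_energy F n T) ->
  (@lebesgue_rV R d).-integrable Omega (EFin \o energy_density n T u) /\
  total_energy F Omega n T u =
  \int[@lebesgue_rV R d]_(x in Omega) energy_density n T u x.
Proof.
move=> Cn Cu CI; have mO := measurable_open_rvec oO.
have Ckin : Ck_dir axes 1 U (fun x => mass_density F n x * dotv (u x) (u x)).
  apply: (Ck_dirM oU); last exact: (Ck_dir_dotv oU).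
  by apply: (Ck_dirM oU Cn); exact: Ck_dir_cst.
have integ f : Ck_dir axes 1 U f -> (@lebesgue_rV R d).-integrable Omega (EFin \o f).
  move=> Cf; apply: (integrable_continuous_rvec oO bO oU OU) => x.
  exact: (Ck_dir_cont Cf).
split.
  by apply: integ; apply: (Ck_dirD oU _ CI); exact: (Ck_dirZ _ oU).
rewrite RintegralD//; [|exact: integ (Ck_dirZ _ oU Ckin)|exact: integ].
by rewrite RintegralZl//; exact: integ.
Qed.

End TotalEnergy.

(** * The discrete balance integrated over the domain *)

Theorem theorem4p1 (R : realType) (F : fluid R) (d : nat)
    (Omega : set 'rV[R]_d)
    (sigma : {finite_measure set (rvec R d) -> \bar R})
    (nu : 'rV[R]_d -> 'rV[R]_d)
    (eta xi Theta : R -> R -> R)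
    (dt : R)
    (n0 T0 n1 T1 mu : 'rV[R]_d -> R)
    (u0 u1 us : 'rV[R]_d -> 'rV[R]_d)
    (rho0 := mass_density F n0)
    (gamma0 := gamma F n0 T0)
    (s0 := entropy F n0 T0)
    (eta0 := fun x => eta (n0 x) (T0 x))
    (lambda0 := fun x => xi (n0 x) (T0 x) - 2 / 3 * eta (n0 x) (T0 x))
    (Theta0 := fun x => Theta (n0 x) (T0 x))
    (c1 := fun x => c_infl F (T1 x))
    (q := fun x => - (Theta0 x *: grad T1 x)) :
  (0 < d)%N ->
  bounded_domain Omega ->
  outward_normal Omega sigma nu ->
  0 < dt ->
  (forall n T, 0 < n -> n < (b_coef F)^-1 -> 0 < T ->
     [/\ 0 < eta n T, 2 / 3 * eta n T < xi n T & 0 <= Theta n T]) ->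
  [/\ Ck_closure 2 Omega n0, Ck_closure 2 Omega n1,
      Ck_closure 2 Omega T0 & Ck_closure 2 Omega T1] ->
  Ckv_closure 2 Omega u0 /\ Ckv_closure 2 Omega u1 ->
  Ck_closure 1 Omega mu /\ Ckv_closure 1 Omega us ->
  [/\ Ck_closure 1 Omega eta0, Ck_closure 1 Omega lambda0
    & Ck_closure 1 Omega Theta0] ->
  (forall x, closure Omega x ->
     [/\ 0 < n0 x < (b_coef F)^-1, 0 < n1 x < (b_coef F)^-1,
         0 < T0 x & 0 < T1 x]) ->
  (forall x, boundary Omega x -> u0 x = 0 /\ u1 x = 0) ->
  {ae sigma, forall x, boundary Omega x ->
     dotv (grad n0 x) (nu x) = 0 /\ dotv (grad n1 x) (nu x) = 0} ->
  (* the boundary conventions on u_* concern u_* alone: the heat flux q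
     keeps the actual boundary values of grad T1 *)
  (forall x, boundary Omega x -> us x = 0) ->
  (forall x, Omega x ->
     mu x = mu_convex F (n1 x) (T1 x) + mu_concave F (n0 x) (T1 x)
            - divg (fun y => c1 y *: grad n1 y) x) ->
  (forall x, Omega x ->
     us x = u0 x - (dt / rho0 x) *: (n0 x *: grad mu x + s0 x *: grad T1 x)) ->
  (forall x, Omega x ->
     (n1 x - n0 x) / dt + divg (fun y => n0 y *: us y) x = 0) ->
  (forall x, Omega x ->
     rho0 x *: (dt^-1 *: (u1 x - u0 x) + us x *m gradv u1 x) =
     - (n0 x *: grad mu x) + gamma0 x *: grad T1 x
     + divm (fun y => eta0 y *: symgrad u1 y) x
     + grad (fun y => lambda0 y * divg u1 y) x) ->
  (forall x, Omega x ->
     (internal_energy F n1 T1 x - internal_energy F n0 T0 x) / dt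
     + divg (fun y => (s0 y * T1 y) *: us y) x =
     - divg q x
     - divg (fun y => (divg (fun z => n0 z *: us z) y * c1 y) *: grad n1 y) x
     - mu x * divg (fun y => n0 y *: us y) x
     - dotv (us x) (gamma0 x *: grad T1 x)
     + eta0 x * ddot (symgrad u1 x) (gradv u1 x)
     + lambda0 x * (divg u1 x) ^+ 2
     + (2 * dt)^-1 * (rho0 x * (dotv (u1 x - us x) (u1 x - us x)
                                + dotv (us x - u0 x) (us x - u0 x)))) ->
  (total_energy F Omega n1 T1 u1 - total_energy F Omega n0 T0 u0) / dt =
  - \int[sigma]_(x in boundary Omega) dotv (q x) (nu x).
Proof.
move=> _ [_ oO _ bO] nuO dt0 _ [Kn0 Kn1 KT0 KT1] [Ku0 Ku1] [Kmu Kus] [Keta Klam KTh].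
move=> adm u_bd n_bd us_bd _ us_eq continuity momentum energy.
pose axes i : 'rV[R]_d := delta_mx 0 i.
have [W [oW OW /(_ W oW (@subset_refl _ W))]] :=
  near_closureI (near_closure_Ck Kn0) (near_closureI (near_closure_Ck Kn1)
 (near_closureI (near_closure_Ck KT0) (near_closureI (near_closure_Ck KT1)
 (near_closureI (near_closure_Ckv Ku0) (near_closureI (near_closure_Ckv Ku1)
 (near_closureI (near_closure_Ck Kmu) (near_closureI (near_closure_Ckv Kus)
 (near_closureI (near_closure_Ck Keta) (near_closureI (near_closure_Ck Klam)
  (near_closure_Ck KTh)))))))))).
move=> [Wn0 [Wn1 [WT0 [WT1 [Wu0 [Wu1 [Wmu [Wus [Weta [Wlam WTh]]]]]]]]]].
(* Positivity and the bound [n < 1/b] are given on the closure; continuity spreads them to an open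
   set, where the state functions are then smooth up to and across the boundary. *)
pose U := (W `&` n0 @^-1` admissible F) `&` (W `&` n1 @^-1` admissible F)
  `&` ((W `&` T0 @^-1` @positives R) `&` (W `&` T1 @^-1` @positives R)).
have UW : U `<=` W by move=> x [[[]]].
have n0U x : U x -> admissible F (n0 x) by case=> [[[]]].
have n1U x : U x -> admissible F (n1 x) by case=> [[_ []]].
have T0U x : U x -> 0 < T0 x by case=> [_ [[]]].
have T1U x : U x -> 0 < T1 x by case=> [_ [_ []]].
have oU : open U.
  have oA := @open_admissible R F; have oP := @open_positives R.
  have oWI f D : Ck_dir axes 2 W f -> open D -> open (W `&` f @^-1` D).
    by move=> Cf oD; apply: open_setI_preimage => // x; exact: (Ck_dir_cont Cf).
  exact: (openI (openI (oWI _ _ Wn0 oA) (oWI _ _ Wn1 oA))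
                (openI (oWI _ _ WT0 oP) (oWI _ _ WT1 oP))).
have OU : closure Omega `<=` U.
  move=> x Ox; have [? ? ? ?] := adm x Ox; have Wx := OW x Ox.
  by split; split; split.
have OmU : Omega `<=` U by apply: subset_trans OU; exact: subset_closure.
have Cn0 := sub_Ck_dir UW Wn0; have Cn1 := sub_Ck_dir UW Wn1.
have CT0 := sub_Ck_dir UW WT0; have CT1 := sub_Ck_dir UW WT1.
have Cu0 : Ckv_dir 1 U u0 by move=> i; exact: Ck_dirW (sub_Ck_dir UW (Wu0 i)).
have C2u1 : Ckv_dir 2 U u1 by move=> i; exact: sub_Ck_dir UW (Wu1 i).
have Cu1 : Ckv_dir 1 U u1 by move=> i; exact: Ck_dirW (C2u1 i).
have Cus : Ckv_dir 1 U us by move=> i; exact: sub_Ck_dir UW (Wus i).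
have Cmu := sub_Ck_dir UW Wmu; have Ceta := sub_Ck_dir UW Weta.
have Clam := sub_Ck_dir UW Wlam; have CTh := sub_Ck_dir UW WTh.

pose M := Mweight F; pose w y := n0 y *: us y.
pose A y := eta0 y *: symgrad u1 y.
(* [H1], [H2], [H3] carry kinetic energy, chemical energy and entropy with [us]; [H5] is the
   density-gradient flux, and [H6], [H7] are the powers of the two viscous stresses. *)
pose H1 y := (2^-1 * M) *: (dotv (u1 y) (u1 y) *: w y).
pose H2 y := mu y *: w y.
pose H3 y := (s0 y * T1 y) *: us y.
(* By the continuity equation - (n1 - n0) / dt is div (n0 us) on Omega; unlike
   the latter it is continuously differentiable up to the boundary. *)
pose H5 y := (- ((n1 y - n0 y) / dt) * c1 y) *: grad n1 y.
pose H6 y := u1 y *m (A y)^T.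
pose H7 y := (lambda0 y * divg u1 y) *: u1 y.
pose H y := H1 y + H2 y + H3 y + q y + H5 y - H6 y - H7 y.
have C1n0 := Ck_dirW Cn0; have C1n1 := Ck_dirW Cn1.
have C1T1 := Ck_dirW CT1.
have Cw : Ckv_dir 1 U w by exact: (Ckv_dirZ oU C1n0 Cus).
have Cuu : Ck_dir axes 1 U (fun y => dotv (u1 y) (u1 y)) by exact: (Ck_dir_dotv oU).
have CH1' : Ckv_dir 1 U (fun y => dotv (u1 y) (u1 y) *: w y).
  exact: (Ckv_dirZ oU Cuu Cw).
have CH1 : Ckv_dir 1 U H1 by exact: (Ckv_dirZ oU (Ck_dir_cst _ _ _ _) CH1').
have CH2 : Ckv_dir 1 U H2 by exact: (Ckv_dirZ oU Cmu Cw).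
have Cgam : Ck_dir axes 1 U gamma0 := Ck_dir_gamma oU n0U T0U Cn0 CT0.
have Cs0 : Ck_dir axes 1 U s0 by exact: (Ck_dirN oU Cgam).
have CH3 : Ckv_dir 1 U H3 by exact: (Ckv_dirZ oU (Ck_dirM oU Cs0 C1T1) Cus).
have Cq : Ckv_dir 1 U q.
  by apply: (Ckv_dirN oU); apply: (Ckv_dirZ oU CTh); exact: Ckv_dir_grad.
have Cc1 : Ck_dir axes 1 U c1 by exact: (Ck_dir_comp oU T1U C1T1 (Ck_real_c_infl F 1)).
have CH5 : Ckv_dir 1 U H5.
  apply: (Ckv_dirZ oU); last exact: Ckv_dir_grad.
  apply: (Ck_dirM oU) Cc1; apply: (Ck_dirN oU).
  apply: (Ck_dirM oU); last exact: Ck_dir_cst.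
  exact: (Ck_dirB oU C1n1 C1n0).
have CA i j : Ck_dir axes 1 U (fun y => A y i j).
  have Csym : Ck_dir axes 1 U (fun y => symgrad u1 y i j).
    apply: (eq_Ck_dir oU) (Ck_dirD oU (Ck_dir_pd i (C2u1 j)) (Ck_dir_pd j (C2u1 i))).
    by move=> y _; rewrite !mxE.
  by apply: (eq_Ck_dir oU) (Ck_dirM oU Ceta Csym) => y _; rewrite [RHS]mxE.
have CH6 : Ckv_dir 1 U H6.
  move=> i; have CuA : Ck_dir axes 1 U (fun y => \sum_j u1 y 0 j * A y i j).
    by apply: (Ck_dir_sum _ oU) => j _; exact: (Ck_dirM oU (Cu1 j) (CA i j)).
  apply: (eq_Ck_dir oU) CuA => y _; rewrite [RHS]mxE.
  by apply: eq_bigr => j _; rewrite [X in _ = _ * X]mxE.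
have Cdiv : Ck_dir axes 1 U (divg u1) by exact: Ck_dir_divg.
have CH7 : Ckv_dir 1 U H7 by exact: (Ckv_dirZ oU (Ck_dirM oU Clam Cdiv) Cu1).
have C12 := Ckv_dirD oU CH1 CH2; have C13 := Ckv_dirD oU C12 CH3.
have C14 := Ckv_dirD oU C13 Cq; have C15 := Ckv_dirD oU C14 CH5.
have CN6 := Ckv_dirN oU CH6; have CN7 := Ckv_dirN oU CH7.
have C16 := Ckv_dirD oU C15 CN6.
have CH : Ckv_dir 1 U H by exact: (Ckv_dirD oU C16 CN7).

have divH x : Omega x -> divg H x =
    - dt^-1 * (energy_density F n1 T1 u1 x - energy_density F n0 T0 u0 x).
  move=> Ox; have Ux := OmU x Ox.
  rewrite [LHS](divgD Ux C16 CN7) (divgD Ux C15 CN6) (divgD Ux C14 CH5).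
  rewrite (divgD Ux C13 Cq) (divgD Ux C12 CH3) (divgD Ux CH1 CH2).
  rewrite (divgN Ux CH7) (divgN Ux CH6).
  rewrite [divg H1 x](divgZc _ Ux CH1') (divgZ Ux Cuu Cw) (grad_dotv oU Ux _ Cu1).
  rewrite [divg H2 x](divgZ Ux Cmu Cw).
  rewrite [divg H6 x](divg_mulmx_tr oU Ux Cu1 CA).
  rewrite [divg H7 x](divgZ Ux (Ck_dirM oU Clam Cdiv) Cu1).
  (* The continuity equation holds on all of the open set [Omega], so the two coefficients agree
     near [x] and not just at [x]. *)
  have H5E : divg H5 x =
      divg (fun y => (divg (fun z => n0 z *: us z) y * c1 y) *: grad n1 y) x.
    apply: (eq_divg oO Ox) => y Oy; congr ((_ * _) *: _).
    by apply/eqP; rewrite eq_sym -addr_eq0 addrC continuity.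
  have Msz : rho0 x != 0.
    have /andP[n00 _] := n0U x Ux.
    by rewrite mulf_neq0 ?lt0r_neq0 ?Mweight_gt0.
  (* The definition of [us] serves twice: tested with [u1] it removes the forces from the momentum
     balance, tested with [us] it brings them back as the power that the energy equation
     compensates. *)
  have ES := congr1 (fun v => dotv v (us x)) (us_eq x Ox).
  have EB := congr1 (fun v => dotv v (u1 x)) (us_eq x Ox).
  have mom := congr1 (fun v => dotv v (u1 x)) (momentum x Ox).
  have ener := energy x Ox.
  rewrite /= dotvBl dotvZl dotvDl !dotvZl in ES.
  rewrite /= dotvBl dotvZl dotvDl !dotvZl in EB.
  rewrite /= dotvZl dotvDl dotvZl dotvBl !dotvDl dotvNl !dotvZl in mom.
  rewrite !dotvBB [dotv (us x) (_ *: _)]dotvC dotvZl -H5E in ener.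
  have s0E : s0 x = - gamma0 x by [].
  rewrite s0E mulNr in ES; rewrite s0E mulNr in EB.
  have dtn0 : dt != 0 by exact: lt0r_neq0.
  have bal := discrete_energy_identity dtn0 Msz (continuity x Ox) ES EB mom ener.
  apply: etrans bal; rewrite -scalemxAl dotvZl ddotZl.
  have -> : dotv (grad mu x) (w x) = n0 x * dotv (grad mu x) (us x).
    by rewrite dotvC dotvZl dotvC.
  by rewrite /M; ring.
have [I1 E1] := total_energyE oO bO oU OU C1n1 Cu1
  (Ck_dir_internal_energy oU n1U T1U Cn1 CT1).
have [I0 E0] := total_energyE oO bO oU OU C1n0 Cu0
  (Ck_dir_internal_energy oU n0U T0U Cn0 CT0).
have mO := measurable_open_rvec oO.
have surf : \int[sigma]_(x in boundary Omega) dotv (H x) (nu x) =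
    \int[sigma]_(x in boundary Omega) dotv (q x) (nu x).
  apply: (eq_surface_integral oO nuO oU OU).
  - by move=> i x; exact: (Ck_dir_cont (CH i)).
  - by move=> i x; exact: (Ck_dir_cont (Cq i)).
  move: n_bd; apply: sub_ae => x n_bdx Bx; have [_ u1x] := u_bd x Bx.
  have [_ n1x] := n_bdx Bx; have usx := us_bd x Bx.
  (* [us = 0] kills [H1], [H2], [H3] and [u1 = 0] kills [H6], [H7]; of [H5] only the normal
     component vanishes. *)
  rewrite /H /H1 /H2 /H3 /H6 /H7 /w usx u1x mul0mx !scaler0 !subr0 !add0r.
  by rewrite dotvDl dotvZl n1x mulr0 addr0.
rewrite -surf -(divergence_theorem oO bO nuO oU OU CH) E1 E0 -RintegralB//.
have IB := integrableB mO I1 I0.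
have -> : \int[@lebesgue_rV R d]_(x in Omega) divg H x =
    \int[@lebesgue_rV R d]_(x in Omega) (- dt^-1 *
      (energy_density F n1 T1 u1 x - energy_density F n0 T0 u0 x)).
  by apply: eq_Rintegral => x; rewrite inE; exact: divH.
by rewrite RintegralZl// mulNr opprK mulrC.
Qed.
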